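(* Let $W:\mathbb{T}\to(-\infty,\infty]$ satisfy (H1)–(H4), let $\alpha\ge0$ and $0<d\le1$. Let $\rho$ be an even minimizer of $\mathcal{G}_\alpha$ over $\mathcal{M}_{\mathcal{D}\ge d}$ such that $I=[-M,M]$ satisfies $\mathcal{D}[\rho]=\rho(I)-|I|$. Then $$\rho=m(\delta_M+\delta_{-M})+\rho_1$$ for some $0<m\le1/2$, where $\rho_1$ is a nonnegative measure of total mass $1-2m$ which is supported and non-zero on two (possibly empty) closed intervals $J\subsetneq I^c$ and $K\subsetneq I$.
   Context: $\mathbb{T}=\mathbb{R}/\mathbb{Z}$ with Lebesgue measure $|\cdot|$; $I^c$ is the complement of $I$ in $\mathbb{T}$. Hypotheses on $W$: (H1) $W\in L^1(\mathbb{T})\cap C^2(\mathbb{T}\setminus\{0\})$, $\int W=0$; (H2) $W$ even; (H3) $\lim_{x\to0}W(x)=W(0)=\infty$; (H4) $W''\ge C_1>0$ on $\mathbb{T}\setminus\{0\}$. $(W*\rho)(x)=\int W(x-y)\,d\rho(y)$; $\mathcal{H}[\rho]=-\operatorname{ess\,inf}(W*\rho)$; $\mathcal{D}[\rho]=\sup_I(\rho(I)-|I|)$ over closed arcs; $\mathcal{G}_\alpha=\mathcal{H}/\mathcal{D}^\alpha$; $\mathcal{M}_{\mathcal{D}\ge d}$ is the set of Borel probability measures with $\mathcal{D}\ge d$; even means $\rho(A)=\rho(-A)$. *)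

(* Defs.v *)
From HB Require Import structures.
From mathcomp Require Import all_boot all_order all_algebra.
From mathcomp Require Import all_classical all_reals all_analysis ess_sup_inf.
Set Implicit Arguments. Unset Strict Implicit. Unset Printing Implicit Defensive.
Import Order.TTheory GRing.Theory Num.Theory.
Import numFieldNormedType.Exports.
Local Open Scope classical_set_scope.
Local Open Scope ring_scope.

(* The torus T = R/Z is modelled through 1-periodic objects on R:
   - a subset of T is a 1-periodic subset of R;
   - a measure on T is represented by a measure on R, evaluated only on
     1-periodic Borel sets (i.e. we look at its push-forward to T);
   - a function on T is a 1-periodic function on R. *)

Definition Rm (R : realType) := measurableTypeR R.

Definition periodic_set (R : realType) (A : set R) : Prop :=
  forall x, A x <-> A (x + 1).

Definition Tset (R : realType) (A : set R) : Prop :=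
  measurable (A : set (Rm R)) /\ periodic_set A.

Definition Tarc (R : realType) (a l : R) : set R :=
  [set x | exists k : int, a <= x + k%:~R <= a + l].

Definition Toarc (R : realType) (a l : R) : set R :=
  [set x | exists k : int, a < x + k%:~R < a + l].

Definition conv (R : realType) (W : R -> \bar R)
  (rho : {measure set (Rm R) -> \bar R}) (x : R) : \bar R :=
  (\int[rho]_y W (x - y)%R)%E.

Definition Hfun (R : realType) (W : R -> \bar R)
  (rho : {measure set (Rm R) -> \bar R}) : \bar R :=
  (- ess_inf (@lebesgue_measure R) (conv W rho))%E.

Definition Dfun (R : realType) (rho : {measure set (Rm R) -> \bar R}) : \bar R :=
  ereal_sup [set (rho (Tarc a l) - l%:E)%E | a in [set: R] &
                                            l in [set l : R | 0 <= l <= 1]].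

Definition Gfun (R : realType) (alpha : R) (W : R -> \bar R)
  (rho : {measure set (Rm R) -> \bar R}) : \bar R :=
  (Hfun W rho * ((fine (Dfun rho)) `^ alpha)^-1%:E)%E.

Definition even_meas (R : realType) (rho : {measure set (Rm R) -> \bar R}) : Prop :=
  forall A : set R, Tset A -> rho A = rho [set - x | x in A].

Definition hyp_W (R : realType) (W : R -> \bar R) : Prop :=
  (forall x, W (x + 1) = W x) /\
  (@lebesgue_measure R).-integrable `[0%R, 1%R] W /\
  (\int[@lebesgue_measure R]_(x in `[0%R, 1%R]) W x = 0)%E /\
  (exists w : R -> R,
     (forall x, 0 < x < 1 -> W x = (w x)%:E) /\
     (forall x, 0 < x < 1 -> derivable w x 1) /\
     (forall x, 0 < x < 1 -> derivable (derive1 w) x 1) /\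
     (forall x, 0 < x < 1 -> {for x, continuous (derive1n 2 w)}) /\
     (exists C1 : R, 0 < C1 /\ forall x, 0 < x < 1 -> C1 <= (derive1n 2 w) x)) /\
  (forall x, W (- x) = W x) /\
  (W 0%R = +oo)%E /\
  (W x @[x --> (0 : R)^'] --> +oo%E).

(* Main.v *)
(** Subtracting its minimum from W gives a nonnegative kernel V; let U be the
    potential of rho for V and h the essential infimum of U. Splitting a little
    mass near a point x <> +-M of the support into two halves moved by +e and -e
    raises the potential away from x, by strong convexity of V. If U(x) > h this
    raises h while keeping rho(I), against minimality; so U <= h on the support
    except possibly at +-M.

    Between two points where U <= h there must be mass of rho: otherwise U is
    strictly convex there and lies below h on an open interval. Since {U <= h} is
    closed, the support in any arc that ends at points with U = +oo is a single
    closed interval. As U = +oo at atoms, it remains to show that +-M are atoms.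

    If they are not, the whole support lies in {U <= h}, hence U <= h everywhere
    and U = h almost everywhere. Then rho is uniform: convolving with the Bernoulli
    polynomial (z - 1/2)^2, a function f whose distance to its minimum is O(t^2)
    at distance t from a minimizer, V * f is still constant, and the convexity of V
    forces f to be constant. But rho uniform gives rho(I) = |I|, so D[rho] = 0 < d. *)

Require Import Defs.
From HB Require Import structures.
From mathcomp Require Import all_boot all_order all_algebra.
From mathcomp Require Import all_classical all_reals all_analysis ess_sup_inf.
From mathcomp Require Import measurable_realfun.
From mathcomp Require Import ring lra.
Set Implicit Arguments. Unset Strict Implicit. Unset Printing Implicit Defensive.
Import Order.TTheory GRing.Theory Num.Theory.
Import numFieldNormedType.Exports.
Local Open Scope classical_set_scope.
Local Open Scope ring_scope.

Local Notation potential := Defs.conv.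

(** * Arcs and integrals over a period *)

(** Since rho has mass 1, passing from W to V turns H into c - h, with c the integral of V, and
    makes all integrands nonnegative: Tonelli and Fatou apply although U may be +oo. Averaging gives
    h <= c, so the numerator of G stays nonnegative, and a larger h with D not smaller strictly
    lowers G. A competitor nu needs only nu(I) = rho(I): then D[nu] >= nu(I) - |I| = D[rho] >= d. So
    mass may move within I or within its complement but not across the boundary, which is why M and
    -M escape the argument.

    The obstacle is that V is convex only between two poles. Splitting mass near x can lower the
    potential near x; the excess U(x) - h, which lower semicontinuity spreads to a neighbourhood,
    pays for this. The pole is again the obstacle for uniformity: the second difference of V is
    uncontrolled near it, and the O(t^2) growth of f at its minimizer makes that part negligible. A
    measure has no pointwise minimum, hence the smoothing; second differences of the Bernoulli
    polynomial see the mass of an arc, so a constant f gives back rho(I) <= |I|. *)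

Lemma measurable_arc_bigcup (R : realType) (F : int -> set R) :
  (forall k, measurable (F k : set (Rm R))) ->
  measurable ([set x | exists k : int, F k x] : set (Rm R)).
Proof.
move=> mF; rewrite (_ : [set x | _] = \bigcup_(k in [set: int]) F k).
  exact: countable_bigcupT_measurable.
by apply/seteqP; split => x /= [k]; [exists k | exists k].
Qed.

Lemma measurable_Tarc (R : realType) (a l : R) : measurable (Tarc a l : set (Rm R)).
Proof.
apply: (@measurable_arc_bigcup R (fun k => [set x | a <= x + k%:~R <= a + l])) => k.
rewrite (_ : [set x | _] = `[a - k%:~R, a + l - k%:~R]%classic).
  exact: measurable_itv.
by apply/seteqP; split => x /=; rewrite in_itv/=; lra.
Qed.

Lemma measurable_Toarc (R : realType) (a l : R) : measurable (Toarc a l : set (Rm R)).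
Proof.
apply: (@measurable_arc_bigcup R (fun k => [set x | a < x + k%:~R < a + l])) => k.
rewrite (_ : [set x | _] = `]a - k%:~R, a + l - k%:~R[%classic).
  exact: measurable_itv.
by apply/seteqP; split => x /=; rewrite in_itv/=; lra.
Qed.

Lemma periodic_intr (R : realType) (T : Type) (g : R -> T) :
  (forall x, g (x + 1) = g x) -> forall (k : int) x, g (x + k%:~R) = g x.
Proof.
move=> gp.
have gn : forall (n : nat) x, g (x + n%:R) = g x.
  elim=> [|n IH] x; first by rewrite addr0.
  by rewrite -addn1 natrD addrA gp IH.
move=> [n|n] x; first exact: gn.
by rewrite NegzE mulrNz -[in RHS](subrK n.+1%:R x) gn.
Qed.

Lemma Tset_intr (R : realType) (A : set R) :
  periodic_set A -> forall (k : int) x, A (x + k%:~R) <-> A x.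
Proof.
move=> Ap k x; have := @periodic_intr R Prop A _ k x.
by move=> -> // y; apply/propext; split; apply Ap.
Qed.

Lemma Tset_Tarc (R : realType) (a l : R) : Tset (Tarc a l).
Proof.
split; first exact: measurable_Tarc.
move=> x; split => -[k h].
  by exists (k - 1); rewrite intrB; lra.
by exists (k + 1); rewrite intrD; lra.
Qed.

Lemma floor_fracP (R : realType) (x : R) :
  exists k : int, 0 <= x - k%:~R < 1.
Proof. by exists (Num.floor x); have := floor_itv x; rewrite intrD; lra. Qed.

Section reflection.
Local Open Scope ereal_scope.
Context {R : realType}.
Local Notation mu := (@lebesgue_measure R).

Lemma measurable_reflect (c : R) :
  measurable_fun [set: measurableTypeR R] (fun w => (c - w)%R : measurableTypeR R).
Proof. exact: measurable_funB. Qed.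

Lemma lebesgue_measure_reflect (c : R) (A : set R) : measurable A ->
  pushforward mu (fun w => (c - w)%R : measurableTypeR R) A = mu A.
Proof.
move=> mA; apply/esym.
apply: lebesgue_measure_unique => //=; first exact: measurable_reflect.
move=> mr _ [[a b]] _ <-.
rewrite /pushforward /=.
rewrite (_ : (fun w => (c - w)%R) @^-1` _ = `[(c - b)%R, (c - a)%R[%classic).
  rewrite !lebesgue_measure_itv/= !lte_fin ltrD2l ltrN2.
  by case: ifP => // _; rewrite -EFinD; congr EFin; ring.
by apply/seteqP; split => x /=; rewrite !in_itv/=; lra.
Qed.

Lemma ge0_integral_reflect (c : R) (D : set R) (f : R -> \bar R) :
  measurable D -> measurable_fun [set: R] f -> (forall r, 0 <= f r) ->
  \int[mu]_(r in D) f r = \int[mu]_(r in (fun w => (c - w)%R) @^-1` D) f (c - r)%R.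
Proof.
move=> mD mf f0.
rewrite -(@ge0_integral_pushforward _ _ _ (measurableTypeR R) R _ (measurable_reflect c) mu D f)//=.
  apply: eq_measure_integral => //= [|mr A mA AD].
    exact: measurable_reflect.
  exact/esym/lebesgue_measure_reflect.
exact: measurable_funS mf.
Qed.

Lemma ge0_integral_shift (c : R) (D : set R) (f : R -> \bar R) :
  measurable D -> measurable_fun [set: R] f -> (forall r, 0 <= f r) ->
  \int[mu]_(r in D) f r = \int[mu]_(r in (fun w => (w + c)%R) @^-1` D) f (r + c)%R.
Proof.
move=> mD mf f0.
(* A translation is the composite of two reflections. *)
rewrite (ge0_integral_reflect c mD mf f0) (ge0_integral_reflect 0)//=.
- rewrite (_ : _ @^-1` _ = (fun w => (w + c)%R) @^-1` D).
    by apply: eq_integral => x _; rewrite sub0r opprK addrC.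
  by apply/seteqP; split => x /=; rewrite sub0r opprK addrC.
- rewrite -[X in measurable X]setTI; exact: measurable_reflect.
- exact: measurableT_comp (measurable_reflect c).
Qed.

Lemma ge0_integral_period (a : R) (f : R -> \bar R) :
  measurable_fun [set: R] f -> (forall r, 0 <= f r) ->
  (forall x, f (x + 1)%R = f x) ->
  \int[mu]_(r in `[a, (a + 1)%R[) f r = \int[mu]_(r in `[0%R, 1%R]) f r.
Proof.
move=> mf f0 fp.
pose n := Num.floor a; pose b := (a - n%:~R)%R.
have b0 : (0 <= b)%R by rewrite subr_ge0 Num.Theory.floor_le.
have b1 : (b < 1)%R.
  by rewrite ltrBlDl -[X in (_ + X)%R]/(1%:~R) -intrD Num.Theory.floorD1_gt.
have mfD (D : set R) : measurable_fun D f by exact: measurable_funS mf.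
rewrite (ge0_integral_shift n%:~R)//.
rewrite (_ : _ @^-1` _ = `[b, (b + 1)%R[%classic); last first.
  by apply/seteqP; split => x /=; rewrite !in_itv/= /b; lra.
under eq_integral do rewrite (periodic_intr fp).
have split2 (x y z : R) : (x <= y)%R -> (y <= z)%R ->
   \int[mu]_(r in `[x, z[) f r = \int[mu]_(r in `[x, y[) f r + \int[mu]_(r in `[y, z[) f r.
  move=> xy yz.
  rewrite (_ : `[x, z[%classic = `[x, y[%classic `|` `[y, z[%classic); last first.
    apply/seteqP; split => w /=; rewrite !in_itv/=.
      by move=> /andP[xw wz]; case: (ltP w y) => h; [left|right]; rewrite ?xw ?wz.
    by move=> [] /andP[h1 h2]; [rewrite h1 (lt_le_trans h2)|rewrite (le_trans xy)].
  rewrite ge0_integral_setU//=; first exact: mfD.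
  apply/disj_setPLR => w /=; rewrite !in_itv/=; lra.
have b2 : (1 <= b + 1)%R by lra.
(* The window [b, b + 1[ is cut at 1, and its tail [1, b + 1[ is moved back to [0, b[. *)
rewrite (split2 _ _ _ (ltW b1) b2).
rewrite [X in _ + X](ge0_integral_shift 1)//.
rewrite (_ : _ @^-1` _ = `[0%R, b[%classic); last first.
  by apply/seteqP; split => x /=; rewrite !in_itv/=; lra.
under [X in _ + X]eq_integral do rewrite fp.
rewrite addeC -(split2 _ _ _ b0 (ltW b1)).
by rewrite integral_itv_bndo_bndc.
Qed.

Lemma ge0_integral_period_reflect (c : R) (f : R -> \bar R) :
  measurable_fun [set: R] f -> (forall r, 0 <= f r) ->
  (forall x, f (x + 1)%R = f x) ->
  \int[mu]_(r in `[0%R, 1%R]) f (c - r)%R = \int[mu]_(r in `[0%R, 1%R]) f r.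
Proof.
move=> mf f0 fp.
have mf' : measurable_fun [set: R] (fun r => f (c - r)%R).
  exact: measurableT_comp (measurable_reflect c).
rewrite -(@ge0_integral_period (c - 1)%R f)//.
rewrite subrK integral_itv_bndo_bndc; last exact: measurable_funS mf.
rewrite [RHS](ge0_integral_reflect c)//.
rewrite (_ : _ @^-1` _ = `[0%R, 1%R]%classic)//.
by apply/seteqP; split => x /=; rewrite !in_itv/=; lra.
Qed.

Lemma ge0_integral_period_shift (c : R) (f : R -> \bar R) :
  measurable_fun [set: R] f -> (forall r, 0 <= f r) ->
  (forall x, f (x + 1)%R = f x) ->
  \int[mu]_(r in `[0%R, 1%R]) f (r - c)%R = \int[mu]_(r in `[0%R, 1%R]) f r.
Proof.
move=> mf f0 fp.
rewrite -[RHS](ge0_integral_period_reflect 0)// -[RHS](ge0_integral_period_reflect c)//.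
- by apply: eq_integral => x _; rewrite sub0r opprB.
- exact: measurableT_comp (measurable_reflect 0).
- by move=> x; rewrite -[LHS]fp; congr f; ring.
Qed.

Lemma tonelli_unit_interval (rho : probability (Rm R) R) (F : R -> R -> \bar R) :
  measurable_fun [set: Rm R * Rm R] (fun z => F z.1 z.2) ->
  (forall x y, 0 <= F x y) ->
  \int[mu]_(x in `[0%R, 1%R]) \int[rho]_y F x y =
  \int[rho]_y \int[mu]_(x in `[0%R, 1%R]) F x y.
Proof.
move=> mF F0; pose D : set (Rm R) := `[0%R, 1%R]%classic.
have mD : measurable D by exact: measurable_itv.
(* The restriction to [0, 1] becomes an indicator in the integrand, so that Tonelli applies on the
   whole product. *)
pose G (z : Rm R * Rm R) := F z.1 z.2 * (\1_D z.1)%:E.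
have mG : measurable_fun setT G.
  apply: emeasurable_funM => //; apply/measurable_EFinP.
  exact: (measurableT_comp (f := \1_D : Rm R -> R) _ measurable_fst).
have G0 z : 0 <= G z by rewrite mule_ge0// lee_fin.
have := fubini_tonelli (m1 := mu) (m2 := rho) G mG G0; rewrite /fubini_F /fubini_G /G /=.
have E1 x : \int[rho]_y (F x y * (\1_D x)%:E) = ((fun x => \int[rho]_y F x y) \_ D) x.
  rewrite patchE indicE; case: ifPn => xD.
    by under eq_integral do rewrite mule1.
  by under eq_integral do rewrite mule0; rewrite integral0.
under eq_integral do rewrite E1.
rewrite -integral_mkcond => ->; apply: eq_integral => y _.
rewrite [RHS]integral_mkcond; apply: eq_integral => x _.
by rewrite patchE indicE; case: ifPn => xD; rewrite ?mule1 ?mule0.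
Qed.

End reflection.

(** * The kernel *)

(** All that is kept of (H1)-(H4) for V. Convexity is stated on chords of a closed period, where the
    ends sit at poles, so that no derivative of V is needed later. *)
Record kernel_spec (R : realType) (V : R -> \bar R) (C : R) : Prop := KernelSpec {
  ker_ge0 : forall x, (0 <= V x)%E;
  ker_per : forall x, V (x + 1) = V x;
  ker_cont : continuous V;
  ker_int : (\int[@lebesgue_measure R]_(x in `[0%R, 1%R]) V x < +oo)%E;
  ker_at0 : V 0 = +oo%E;
  ker_C : 0 < C;
  ker_conv : forall a b s : R, 0 <= a -> a < b -> b <= 1 -> 0 < s -> s < 1 ->
    (V ((1 - s) * a + s * b)%R + (C * (s * (1 - s)) * (b - a) ^+ 2)%:E
      <= (1 - s)%:E * V a + s%:E * V b)%E }.

(** Subtracting C/2 y^2 leaves a function g with nondecreasing derivative; the mean value theorem on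
    either side of the intermediate point compares its two slopes. *)
Lemma strong_convexity (R : realType) (w : R -> R) (C : R) :
  (forall x, 0 < x < 1 -> derivable w x 1) ->
  (forall x, 0 < x < 1 -> derivable (derive1 w) x 1) ->
  (forall x, 0 < x < 1 -> C <= derive1n 2 w x) ->
  forall a b s : R, 0 < a -> a < b -> b < 1 -> 0 < s -> s < 1 ->
  w ((1 - s) * a + s * b) + C / 2 * (s * (1 - s)) * (b - a) ^+ 2
    <= (1 - s) * w a + s * w b.
Proof.
move=> dw ddw hC a b s a0 ab b1 s0 s1.
set x := (1 - s) * a + s * b.
have xa : x - a = s * (b - a) by rewrite /x; ring.
have bx : b - x = (1 - s) * (b - a) by rewrite /x; ring.
have ax : a < x by rewrite -subr_gt0 xa mulr_gt0 ?subr_gt0.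
have xb : x < b by rewrite -subr_gt0 bx mulr_gt0 ?subr_gt0.
pose g y := w y - C / 2 * y ^+ 2.
have dg (y : R) : 0 < y < 1 -> is_derive y 1 g (derive1 w y - C * y).
  move=> y01; have dwy : is_derive y 1 w (derive1 w y).
    by rewrite derive1E; apply: DeriveDef => //; exact: dw.
  apply: is_derive_eq.
  by rewrite /GRing.scale /= !mulr1; field.
have MV (u v : R) : 0 < u -> u < v -> v < 1 ->
    exists2 c, u < c < v & g v - g u = (derive1 w c - C * c) * (v - u).
  move=> u0 uv v1.
  have inI (z : R) : z \in `[u, v] -> 0 < z < 1 by rewrite in_itv/=; lra.
  have [||c cuv ->] := @MVT R g (fun c => derive1 w c - C * c) u v uv.
  - by move=> z zuv; apply: dg; apply: inI; move: zuv; rewrite !in_itv/=; lra.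
  - apply: derivable_within_continuous => z /inI /dg [].
    by [].
  - by exists c; [move: cuv; rewrite in_itv|].
have mono (u v : R) : 0 < u -> u < v -> v < 1 ->
    derive1 w u - C * u <= derive1 w v - C * v.
  move=> u0 uv v1.
  have inI (z : R) : z \in `[u, v] -> 0 < z < 1 by rewrite in_itv/=; lra.
  have [||c cuv e] := @MVT R (derive1 w) (derive1n 2 w) u v uv.
  - move=> z zuv; rewrite /derive1n/= derive1E; apply: DeriveDef => //.
    by apply: ddw; apply: inI; move: zuv; rewrite !in_itv/=; lra.
  - by apply: derivable_within_continuous => z /inI /ddw.
  - have := hC c; rewrite in_itv/= in cuv.
    have c01 : 0 < c < 1 by lra.
    move=> /(_ c01) hc; rewrite -subr_ge0.
    have -> : derive1 w v - C * v - (derive1 w u - C * u) =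
       (derive1 w v - derive1 w u) - C * (v - u) by ring.
    by rewrite e -mulrBl mulr_ge0// subr_ge0// ltW.
have [c1 c1I e1] := MV a x a0 ax (lt_trans xb b1).
have [c2 c2I e2] := MV x b (lt_trans a0 ax) xb b1.
have c12 : derive1 w c1 - C * c1 <= derive1 w c2 - C * c2 by apply: mono; lra.
rewrite xa in e1; rewrite bx in e2.
set k1 := derive1 w c1 - C * c1 in e1 c12.
set k2 := derive1 w c2 - C * c2 in e2 c12.
have h : g x <= (1 - s) * g a + s * g b.
  have : 0 <= (k2 - k1) * (s * (1 - s) * (b - a)).
    by rewrite mulr_ge0 ?subr_ge0// !mulr_ge0 ?subr_ge0// ltW.
  have -> : (k2 - k1) * (s * (1 - s) * (b - a)) =
    s * (k2 * ((1 - s) * (b - a))) - (1 - s) * (k1 * (s * (b - a))) by ring.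
  by rewrite -e1 -e2; nra.
move: h; rewrite /g.
(* The convexity defect of the square is exactly s (1 - s) (b - a)^2; it restores the quadratic
   term. *)
have -> : x ^+ 2 = (1 - s) * a ^+ 2 + s * b ^+ 2 - s * (1 - s) * (b - a) ^+ 2.
  by rewrite /x; ring.
by nra.
Qed.

Lemma EFin_continuous_at (R : realType) (W : R -> \bar R) (w : R -> R) (x : R) :
  (\forall y \near x, W y = (w y)%:E) -> {for x, continuous w} ->
  {for x, continuous W}.
Proof.
move=> Ww cw; rewrite /prop_for /continuous_at (nbhs_singleton Ww).
have : (w y)%:E @[y --> x] --> (w x)%:E by apply: cvg_EFin; [exact: nearW|].
apply: cvg_trans; apply: near_eq_cvg; near=> y.
by apply/esym; near: y.
Unshelve. all: by end_near. Qed.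

Lemma periodic_continuous (R : realType) (W : R -> \bar R) :
  (forall x, W (x + 1) = W x) ->
  (forall x, 0 <= x < 1 -> {for x, continuous W}) -> continuous W.
Proof.
move=> Wp cW x.
have -> : W = W \o (fun y => y + - (Num.floor x)%:~R).
  by apply/funext => y /=; rewrite -mulrNz (periodic_intr Wp).
apply: continuous_comp.
  by apply: cvgD; [exact: cvg_id|exact: cvg_cst].
apply: cW; have := floor_itv x; rewrite intrD.
by lra.
Qed.

Lemma kernel_of_hyp_W (R : realType) (W : R -> \bar R) : hyp_W W ->
  exists V c0 C, [/\ kernel_spec V C, forall x, W x = (V x + c0%:E)%E &
    (\int[@lebesgue_measure R]_(x in `[0%R, 1%R]) V x = (- c0)%:E)%E].
Proof.
move=> [Wp [Wi [W0 [[w [Ww [dw [ddw [_ [C [C0 hC]]]]]]] [We [Winf Wlim]]]]]].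
have cv := strong_convexity dw ddw hC.
have wsym (x : R) : 0 < x < 1 -> w (1 - x) = w x.
  move=> x01; apply: EFin_inj; rewrite -!Ww//; last by lra.
  by rewrite addrC Wp We.
(* The symmetry x -> 1 - x and convexity put the minimum over a period at 1/2. *)
pose c0 := w (1 / 2).
have wc0 (x : R) : 0 < x < 1 -> c0 <= w x.
  have hlt (y : R) : 0 < y -> y < 1 / 2 -> c0 <= w y.
    move=> y0 y2.
    have y1 : y < 1 - y by lra.
    have y1' : 1 - y < 1 by lra.
    have h1 : 0 < 1 / 2 :> R by lra.
    have h2 : 1 / 2 < 1 :> R by lra.
    have := cv y (1 - y) (1 / 2) y0 y1 y1' h1 h2.
    rewrite wsym; last lra.
    rewrite (_ : (1 - 1 / 2) * y + 1 / 2 * (1 - y) = 1 / 2); last by field.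
    rewrite -/c0; have : 0 <= C / 2 * (1 / 2 * (1 - 1 / 2)) * (1 - y - y) ^+ 2.
      by rewrite mulr_ge0 ?sqr_ge0//; lra.
    lra.
  move=> x01; have [xl|xg|->//] := ltgtP x (1 / 2).
  - by apply: hlt => //; lra.
  - by rewrite -wsym//; apply: hlt; lra.
have Wc0 x : (c0%:E <= W x)%E.
  have -> : W x = W (x - (Num.floor x)%:~R).
    by rewrite -mulrNz (periodic_intr Wp).
  have := floor_itv x; rewrite intrD => fx.
  have [->|xn0] := eqVneq (x - (Num.floor x)%:~R) 0; first by rewrite Winf leey.
  have xp : 0 < x - (Num.floor x)%:~R by rewrite lt_def xn0/=; lra.
  by rewrite Ww ?lee_fin; [apply: wc0; lra|lra].
have cW : continuous W.
  apply: periodic_continuous => // x x01.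
  have [->|xn0] := eqVneq x 0.
    rewrite /prop_for /continuous_at Winf.
    move=> A /= Aoo; rewrite nbhs_nearE dnbhsE; split; first exact: Wlim.
    by apply/principal_filterP; rewrite /= Winf; exact: nbhs_singleton.
  have xp : 0 < x by rewrite lt_def xn0/=; lra.
  apply: (@EFin_continuous_at R W w).
    near=> y; apply: Ww; apply/andP; split; near: y.
      exact: lt_nbhsr.
    by apply: lt_nbhsl; lra.
  apply: differentiable_continuous; apply/derivable1_diffP; apply: dw; lra.
pose V x := (W x - c0%:E)%E.
have V0 x : (0 <= V x)%E by rewrite /V sube_ge0// Wc0.
have WV x : W x = (V x + c0%:E)%E by rewrite /V subeK.
have intV : (\int[@lebesgue_measure R]_(x in `[0%R, 1%R]) V x = (- c0)%:E)%E.
  rewrite integralB//=.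
  - rewrite W0 integral_cst//= lebesgue_measure_itv/= lte_fin ltr01.
    by rewrite oppr0 adde0 mule1 sub0e.
  - apply/integrableP; split => //=.
    rewrite integral_cst//= lebesgue_measure_itv/= lte_fin ltr01.
    by rewrite oppr0 adde0 mule1 ltry.
exists V, c0, (C / 2); split => //; split => //.
- by move=> x; rewrite /V Wp.
- move=> x; rewrite /V; apply: cvgeB => //; [|exact: cW|exact: cvg_cst].
  by rewrite fin_num_adde_defl.
- by rewrite intV ltry.
- by rewrite /V Winf.
- by lra.
- move=> a b s a0 ab b1 s0 s1.
  (* A chord that ends at a pole has an infinite right-hand side; any other chord lies in ]0, 1[,
     where W is w. *)
  have h1 : ((1 - s)%:E * V a + s%:E * V b)%E = +oo%E \/ (0 < a /\ b < 1).
    have sp : (0 < s%:E)%E by rewrite lte_fin.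
    have sp' : (0 < (1 - s)%:E)%E by rewrite lte_fin; lra.
    have [->|an0] := eqVneq a 0.
      have -> : V 0 = +oo%E by rewrite /V Winf.
      left; rewrite gt0_muley// addye// gt_eqF// (@lt_le_trans _ _ 0%E)//.
      by rewrite mule_ge0// ltW.
    have [->|bn1] := eqVneq b 1.
      have -> : V 1 = +oo%E by rewrite /V -[1]add0r Wp Winf.
      left; rewrite gt0_muley// addey// gt_eqF// (@lt_le_trans _ _ 0%E)//.
      by rewrite mule_ge0// ltW.
    by right; rewrite lt_def an0 a0 lt_def eq_sym bn1 b1.
  case: h1 => [->|[a0' b1']]; first by rewrite leey.
  have x01 : 0 < (1 - s) * a + s * b < 1 by nra.
  rewrite /V !Ww; [|lra|lra|lra].
  rewrite -!EFinB -!EFinM -!EFinD lee_fin.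
  by have := cv a b s a0' ab b1' s0 s1; nra.
Unshelve. all: by end_near. Qed.

(** * Potentials *)

Section potential.
Context {R : realType} (V : R -> \bar R) (C : R).
Hypothesis kV : kernel_spec V C.
Local Notation mu := (@lebesgue_measure R).

Lemma ker_measurable : measurable_fun [set: Rm R] (V : Rm R -> \bar R).
Proof.
apply: lower_semicontinuous_measurable => x a ax.
exists [set y | (a%:E < V y)%E] => //.
have h : nbhs (V x) [set z | (a%:E < z)%E].
  by apply: open_nbhs_nbhs; split => //; exact: open_ereal_gt_ereal.
exact: (ker_cont kV h).
Qed.

Lemma measurable_kernel_reflect (x : R) :
  measurable_fun [set: Rm R] (fun y : Rm R => V (x - y)).
Proof. exact: measurableT_comp ker_measurable (measurable_reflect x). Qed.

Lemma measurable_kernel_diff :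
  measurable_fun [set: Rm R * Rm R] (fun z => V (z.1 - z.2)).
Proof.
apply: (measurableT_comp ker_measurable).
exact: measurable_funB.
Qed.

Variable rho : probability (Rm R) R.

Lemma potential_ge0 x : (0 <= potential V rho x)%E.
Proof. by apply: integral_ge0 => y _; exact: (ker_ge0 kV). Qed.

Lemma potential_periodic x : potential V rho (x + 1) = potential V rho x.
Proof.
by apply: eq_integral => y _; rewrite -[RHS](ker_per kV) addrAC.
Qed.

(** Fatou's lemma: V is nonnegative and continuous into the extended reals, so V (u n - y) tends to
    V (x - y) for every y, at the poles too. *)
Lemma potential_lsc_seq (x : R) (u r : nat -> R) (l : R) :
  u @ \oo --> x -> r @ \oo --> l ->
  (forall n, (potential V rho (u n) <= (r n)%:E)%E) -> (potential V rho x <= l%:E)%E.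
Proof.
move=> ux rl ur.
have -> : potential V rho x = (\int[rho]_y limn_einf (fun n => V (u n - y)))%E.
  apply: eq_integral => y _.
  have h : (fun n => V (u n - y)) @ \oo --> V (x - y).
    apply: (cvg_comp (fun n => u n - y) V); last exact: (ker_cont kV).
    by apply: cvgB => //; exact: cvg_cst.
  by rewrite (cvg_limn_einf_sup h).
apply: le_trans.
  apply: (@fatou _ _ _ rho setT measurableT (fun n y => V (u n - y))).
    by move=> n; exact: measurable_kernel_reflect.
  by move=> n y _; exact: (ker_ge0 kV).
have rl' : (fun n => (r n)%:E) @ \oo --> l%:E.
  by apply: cvg_EFin => //; exact: nearW.
rewrite limn_einf_lim -(cvg_lim _ rl')//; apply: lee_lim.
- exact: is_cvg_einfs.
- by apply/cvg_ex; exists l%:E.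
- apply: nearW => n; apply: (le_trans _ (ur n)).
  by apply: ereal_inf_lbound; exists n => //=.
Qed.

Lemma potential_lsc (x a : R) : (a%:E < potential V rho x)%E ->
  exists2 e : R, 0 < e & forall y, `|y - x| < e -> (a%:E < potential V rho y)%E.
Proof.
move=> ax; apply: contrapT => H.
have {}H n : exists y, `|y - x| < n.+1%:R^-1 /\ (potential V rho y <= a%:E)%E.
  apply: contrapT => H'; apply: H; exists n.+1%:R^-1 => // y yx.
  by rewrite ltNge; apply/negP => ya; apply: H'; exists y.
have [u uP] := choice H.
move: ax; rewrite ltNge => /negP; apply.
apply: (@potential_lsc_seq x u (fun _ => a)) => //; last by move=> n; case: (uP n).
  apply/cvgrPdist_lt => e e0.
  have /cvgr_dist_lt/(_ _ e0) := @cvg_harmonic R; apply: filterS => n.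
  rewrite /harmonic/= sub0r normrN => h; rewrite distrC.
  by have [/lt_trans + _] := uP n; apply; rewrite (le_lt_trans _ h)// ler_norm.
exact: cvg_cst.
Qed.

Lemma integral_potential :
  (\int[mu]_(x in `[0%R, 1%R]) potential V rho x =
   \int[mu]_(x in `[0%R, 1%R]) V x)%E.
Proof.
rewrite tonelli_unit_interval/=.
- under eq_integral do rewrite (ge0_integral_period_shift _ ker_measurable (ker_ge0 kV) (ker_per kV)).
  by rewrite integral_cst//= probability_setT mule1.
- exact: measurable_kernel_diff.
- by move=> *; exact: (ker_ge0 kV).
Qed.

Lemma measurable_potential :
  measurable_fun [set: Rm R] (potential V rho : Rm R -> \bar R).
Proof.
apply: lower_semicontinuous_measurable => x a /potential_lsc[e e0 he].
exists (ball x e); first exact: nbhsx_ballx.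
by move=> y; rewrite /ball/= distrC => /he.
Qed.

(** By Tonelli the mean of the potential over a period is the integral of V, and a lower bound valid
    almost everywhere cannot exceed the mean. *)
Lemma ess_inf_potential_le (h : \bar R) :
  (\forall x \ae mu, h <= potential V rho x)%E ->
  (h <= \int[mu]_(x in `[0%R, 1%R]) V x)%E.
Proof.
move=> hU; have [h0|h0] := leP 0%E h; last first.
  by rewrite (le_trans (ltW h0))// integral_ge0// => x _; exact: (ker_ge0 kV).
rewrite -integral_potential.
have -> : h = (\int[mu]_(x in `[0%R, 1%R]) (cst h x))%E.
  by rewrite integral_cst//= lebesgue_measure_itv/= lte_fin ltr01 oppr0 adde0 mule1.
apply: ae_ge0_le_integral => //.
- by move=> x _; exact: potential_ge0.
- exact: measurable_funS measurable_potential.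
- by have F := ae_filter_ringOfSetsType mu; apply: filterS hU => x + _.
Qed.

Lemma integral_kernel_fin :
  (\int[mu]_(x in `[0%R, 1%R]) V x)%E \is a fin_num.
Proof.
rewrite ge0_fin_numE; first exact: (ker_int kV).
by apply: integral_ge0 => x _; exact: (ker_ge0 kV).
Qed.

End potential.

(** * Perturbing a measure *)

Lemma pushforward_probability (R : realType) (rho : probability (Rm R) R)
    (T : R -> R) (mT : measurable_fun [set: Rm R] (T : Rm R -> Rm R)) :
  exists nu : probability (Rm R) R,
    (forall A, nu A = rho (T @^-1` A)) /\
    (forall f : R -> \bar R, measurable_fun [set: Rm R] f ->
      (forall y, 0 <= f y)%E -> (\int[nu]_y f y = \int[rho]_y f (T y))%E).
Proof.
pose X : {mfun Rm R >-> Rm R} :=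
  HB.pack (T : Rm R -> Rm R) (isMeasurableFun.Build _ _ _ _ _ mT).
exists (distribution rho X); split => // f mf f0.
exact: (ge0_integral_distribution X mf f0).
Qed.

Lemma mixture_probability (R : realType) (m1 m2 : probability (Rm R) R) (t : R) :
  0 <= t <= 1 -> exists nu : probability (Rm R) R,
    (forall A, nu A = ((1 - t)%:E * m1 A + t%:E * m2 A)%E) /\
    (forall f : R -> \bar R, measurable_fun [set: Rm R] f ->
      (forall y, 0 <= f y)%E ->
      (\int[nu]_y f y = (1 - t)%:E * \int[m1]_y f y + t%:E * \int[m2]_y f y)%E).
Proof.
move=> /andP[t0 t1]; have s0 : 0 <= 1 - t by rewrite subr_ge0.
pose m : {measure set (Rm R) -> \bar R} := measure_add (mscale (NngNum s0) m1) (mscale (NngNum t0) m2).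
have mE A : m A = ((1 - t)%:E * m1 A + t%:E * m2 A)%E.
  exact: measure_addE.
have m1E : m setT = 1%E.
  by rewrite mE; rewrite !probability_setT !mule1 -EFinD subrK.
(* The mixture already has mass 1; normalizing it only supplies the structure of a probability. *)
have nE A : mnormalize m m1 A = m A.
  by rewrite /mnormalize m1E/= onee_eq0/= invr1 mule1.
exists (mnormalize m m1); split => [A|f mf f0]; first exact: etrans (nE A) (mE A).
transitivity (\int[m]_y f y)%E.
  by apply: eq_measure_integral => A mA _; exact: nE.
by rewrite ge0_integral_measure_add// !ge0_integral_mscale.
Qed.

(** * Two uses of strong convexity: arcs without mass, and splitting mass near a point *)

Section gap_sweep.
Context {R : realType} (V : R -> \bar R) (C : R).
Hypothesis kV : kernel_spec V C.
Variable rho : probability (Rm R) R.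
Local Notation mu := (@lebesgue_measure R).

Lemma kernel_intr (k : int) x : V (x - k%:~R) = V x.
Proof. by rewrite -mulrNz (periodic_intr (ker_per kV)). Qed.

(** If y has no translate strictly between p and q, then V (. - y) is strongly convex on [p, q],
    with a gain c that does not depend on y. Almost every y is of this kind, so integration keeps
    the whole gain. *)
Lemma potential_gap_lt (h p q s : R) : p < q -> q <= p + 1 ->
  rho (Toarc p (q - p)) = 0%E ->
  (potential V rho p <= h%:E)%E -> (potential V rho q <= h%:E)%E ->
  0 < s < 1 -> (potential V rho ((1 - s) * p + s * q)%R < h%:E)%E.
Proof.
move=> pq qp1 N0 Up Uq /andP[s0 s1].
set x := (1 - s) * p + s * q; pose c := C * (s * (1 - s)) * (q - p) ^+ 2.
have c0 : 0 < c.
  rewrite /c mulr_gt0 ?exprn_gt0 ?subr_gt0// mulr_gt0 ?(ker_C kV)//.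
  by rewrite mulr_gt0// subr_gt0.
have s1' : 0 <= 1 - s by rewrite subr_ge0 ltW.
have s0' := ltW s0.
have pt y : ~ Toarc p (q - p) y ->
    (V (x - y)%R + c%:E <= (1 - s)%:E * V (p - y)%R + s%:E * V (q - y)%R)%E.
  move=> yN; have [n npy] := floor_fracP (p - y).
  (* Otherwise y + n + 1 would lie strictly between p and q. *)
  have b1 : q - y - n%:~R <= 1.
    rewrite leNgt; apply/negP => hb; apply: yN.
    by exists (n + 1); rewrite intrD; lra.
  rewrite -(kernel_intr n (x - y)) -(kernel_intr n (p - y)) -(kernel_intr n (q - y)).
  have -> : x - y - n%:~R = (1 - s) * (p - y - n%:~R) + s * (q - y - n%:~R).
    by rewrite /x; ring.
  have -> : c = C * (s * (1 - s)) * (q - y - n%:~R - (p - y - n%:~R)) ^+ 2.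
    by rewrite /c; ring.
  by apply: (ker_conv kV) => //; lra.
have mk z := measurable_kernel_reflect kV z.
have h1 : (potential V rho x + c%:E <= h%:E)%E.
  have -> : (potential V rho x + c%:E = \int[rho]_y (V (x - y)%R + c%:E))%E.
    rewrite ge0_integralD//=.
    - by rewrite integral_cst//= probability_setT mule1.
    - by move=> y _; exact: (ker_ge0 kV).
    - by move=> y _; rewrite lee_fin (ltW c0).
  have -> : h%:E = ((1 - s)%:E * h%:E + s%:E * h%:E)%E.
    by rewrite -!EFinM -EFinD; congr EFin; ring.
  apply: (@le_trans _ _ ((1 - s)%:E * potential V rho p + s%:E * potential V rho q))%E; last first.
    by apply: leeD; apply: lee_wpmul2l => //; rewrite lee_fin ltW.
  have -> : ((1 - s)%:E * potential V rho p + s%:E * potential V rho q =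
    \int[rho]_y ((1 - s)%:E * V (p - y)%R + s%:E * V (q - y)%R))%E.
    rewrite ge0_integralD//=.
    - by rewrite !ge0_integralZl_EFin//= ?ltW// => y _; exact: (ker_ge0 kV).
    - by move=> y _; rewrite mule_ge0 ?lee_fin//; exact: (ker_ge0 kV).
    - exact: measurable_funeM.
    - by move=> y _; rewrite mule_ge0 ?lee_fin//; exact: (ker_ge0 kV).
    - exact: measurable_funeM.
  apply: ae_ge0_le_integral => //.
  - by move=> y _; rewrite adde_ge0 ?lee_fin ?(ltW c0)//; exact: (ker_ge0 kV).
  - exact: emeasurable_funD.
  - by move=> y _; rewrite adde_ge0// mule_ge0 ?lee_fin//; exact: (ker_ge0 kV).
  - by apply: emeasurable_funD; exact: measurable_funeM.
  - exists (Toarc p (q - p)); split => //; first exact: measurable_Toarc.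
    by move=> y /= H; apply: contrapT => yN; apply: H => _; exact: pt.
move: h1; case: (potential V rho x) (potential_ge0 kV rho x) => [r|_|_]//=.
by rewrite -EFinD !lee_fin lte_fin => _; lra.
Qed.

(** The potential would lie strictly below h on ]p, q[, which has positive length. *)
Lemma no_gap (h p q : R) : p < q -> q <= p + 1 ->
  rho (Toarc p (q - p)) = 0%E ->
  (potential V rho p <= h%:E)%E -> (potential V rho q <= h%:E)%E ->
  ~ (\forall x \ae mu, (h%:E <= potential V rho x)%E).
Proof.
move=> pq qp1 N0 Up Uq [N [mN muN hN]].
have sub : `]p, q[%classic `<=` N.
  move=> x /=; rewrite in_itv/= => xpq; apply: hN => /=; apply/negP.
  rewrite -ltNge; pose s := (x - p) / (q - p).
  have qp : 0 < q - p by rewrite subr_gt0.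
  have -> : x = (1 - s) * p + s * q by rewrite /s; field; rewrite gt_eqF.
  apply: potential_gap_lt => //; rewrite /s divr_gt0//=; last lra.
  by rewrite ltr_pdivrMr//; lra.
have : (mu `]p, q[%classic <= mu N)%E.
  by apply: le_measure => //; rewrite inE //; exact: measurable_itv.
have -> : mu N = 0%E by [].
have -> : mu `]p, q[%classic = (q - p)%:E.
  by rewrite lebesgue_measure_itv/= lte_fin pq.
by rewrite lee_fin; lra.
Qed.

Lemma kernel_second_difference (z e : R) : 0 < e ->
  (forall k : int, ~~ (- e <= z + k%:~R <= e)) ->
  (V z + V z + (2 * (C * e ^+ 2))%:E <= V (z - e)%R + V (z + e)%R)%E.
Proof.
move=> e0 he; have [n nz] := floor_fracP z.
have h1 : e < z - n%:~R.
  by have := he (- n); rewrite mulrNz; lra.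
have h2 : z - n%:~R + e < 1.
  by have := he (- n - 1); rewrite intrB mulrNz; lra.
rewrite -(kernel_intr n z) -(kernel_intr n (z - e)) -(kernel_intr n (z + e)).
set r := z - n%:~R in h1 h2 *.
(* The midpoint of a chord of length 2 e: the defect C (1/4) (2 e)^2 is C e^2, and doubling gives
   the claim. *)
have := @ker_conv _ _ _ kV (r - e) (r + e) 2^-1.
have -> : z - e - n%:~R = r - e by rewrite /r; ring.
have -> : z + e - n%:~R = r + e by rewrite /r; ring.
have -> : (1 - 2^-1) * (r - e) + 2^-1 * (r + e) = r by field.
have -> : C * (2^-1 * (1 - 2^-1)) * (r + e - (r - e)) ^+ 2 = C * e ^+ 2 by field.
have a1 : 0 <= r - e by lra.
have a2 : r - e < r + e by lra.
have a3 : r + e <= 1 by lra.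
have a4 : 0 < 2^-1 :> R by rewrite invr_gt0.
have a5 : 2^-1 < 1 :> R by rewrite invf_lt1// ltr1n.
move=> /(_ a1 a2 a3 a4 a5).
move: (V r) (V (r - e)) (V (r + e)) (ker_ge0 kV r) (ker_ge0 kV (r - e)) (ker_ge0 kV (r + e)).
set K := C * e ^+ 2.
move=> [v| |] [a| |] [b| |] //=; rewrite ?addye ?addey ?leey// => _ _ _.
by rewrite -!EFinM -!EFinD !lee_fin; lra.
Qed.

(** For finite values the right-hand side is u + t ((i1 + i2)/2 - u), where the bracket is at least
    c/2. Here u is the old potential and i1, i2 are those after the two displacements; infinite
    values are treated apart. *)
Lemma averaged_lower_bound (u i1 i2 : \bar R) (h c g t : R) :
  0 < t <= 1 -> g <= t * (c / 2) ->
  (0 <= u -> 0 <= i1 -> 0 <= i2 -> h%:E <= u -> u + u + c%:E <= i1 + i2 ->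
   (h + g)%:E <= (1 - t)%:E * u + t%:E * (2^-1%:E * i1 + 2^-1%:E * i2))%E.
Proof.
move=> /andP[t0 t1] gt u0 i10 i20 hu.
have half : (0 < 2^-1%:E :> \bar R)%E by rewrite lte_fin invr_gt0.
have tu : (0 <= (1 - t)%:E * u)%E by rewrite mule_ge0// lee_fin subr_ge0.
have [i1oo|i1f] := eqVneq i1 +oo%E.
  move=> _; rewrite i1oo gt0_muley// addye; last first.
    by rewrite gt_eqF// (@lt_le_trans _ _ 0%E)// mule_ge0// ltW.
  by rewrite gt0_muley ?lte_fin// addey ?leey// gt_eqF// (@lt_le_trans _ _ 0%E).
have [i2oo|i2f] := eqVneq i2 +oo%E.
  move=> _; rewrite i2oo gt0_muley// addey; last first.
    by rewrite gt_eqF// (@lt_le_trans _ _ 0%E)// mule_ge0// ltW.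
  by rewrite gt0_muley ?lte_fin// addey ?leey// gt_eqF// (@lt_le_trans _ _ 0%E).
move: u i1 i2 u0 i10 i20 hu tu i1f i2f => [u| |] [i1| |] [i2| |] //= _ _ _.
rewrite lee_fin => hu _ _ _; rewrite -!EFinM -!EFinD !lee_fin => H.
have -> : (1 - t) * u + t * (2^-1 * i1 + 2^-1 * i2) =
   u + t * ((i1 + i2 - (u + u)) / 2) by field.
apply: lerD => //; apply: (le_trans gt); rewrite ler_pM2l// ler_pM2r ?invr_gt0//.
lra.
Qed.

(** Outside the arc of radius 2 e, the displacements by e stay clear of the pole and the second
    difference of V gives a uniform gain. Inside it, the unmoved fraction 1 - t alone keeps the
    potential above h, thanks to the slack eta. No displaced point leaves the larger arc, so sets
    that contain or avoid it keep their measure. *)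
Lemma sweep (x e h eta : R) : 0 < e -> 0 < eta -> 0 <= h ->
  (0 < rho (Toarc (x - e) (2 * e)))%E ->
  (forall z, Toarc (x - 2 * e) (4 * e) z -> (h + eta)%:E <= potential V rho z)%E ->
  (\forall z \ae mu, (h%:E <= potential V rho z)%E) ->
  exists nu : probability (Rm R) R, exists g : R, [/\ 0 < g,
    (\forall z \ae mu, ((h + g)%:E <= potential V nu z)%E) &
    forall A : set R, Tset A ->
      Toarc (x - 2 * e) (4 * e) `<=` A \/ Toarc (x - 2 * e) (4 * e) `<=` ~` A ->
      nu A = rho A].
Proof.
move=> e0 eta0 h0 rB hin hae.
set B := Toarc (x - e) (2 * e) in rB *; set B2 := Toarc (x - 2 * e) (4 * e) in hin *.
have mB : measurable (B : set (Rm R)) by exact: measurable_Toarc.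
(* A fraction t of the mass of B goes half to B + e and half to B - e. *)
pose T (s y : R) := y + s * e * \1_B y.
have mT s : measurable_fun [set: Rm R] (T s : Rm R -> Rm R).
  apply: measurable_funD => //; apply: measurable_funM => //.
have [n1 [n1E n1I]] := pushforward_probability rho (mT 1).
have [n2 [n2E n2I]] := pushforward_probability rho (mT (-1)).
have half01 : 0 <= (2^-1 : R) <= 1 by rewrite invr_ge0 ler0n/= invf_le1// ler1n.
have [n3 [n3E n3I]] := mixture_probability n1 n2 half01.
(* Solves (1 - t) (h + eta) = h + eta / 2, so that half of the slack is spent. *)
pose t := eta / (2 * (h + eta)).
have he0 : 0 < h + eta by rewrite ltr_wpDl.
have t0 : 0 < t by rewrite /t divr_gt0// mulr_gt0.
have tE : (1 - t) * (h + eta) = h + eta / 2.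
  by rewrite /t; field; rewrite gt_eqF.
have t1 : t <= 1 by rewrite /t ler_pdivrMr ?mul1r; lra.
have t01 : 0 <= t <= 1 by rewrite ltW.
have [nu [nuE nuI]] := mixture_probability rho n3 t01.
have rBfin : rho B \is a fin_num by exact: fin_num_measure.
pose b := fine (rho B).
have bE : rho B = b%:E by rewrite /b fineK.
have b0 : 0 < b by rewrite -lte_fin -bE.
have mk z := measurable_kernel_reflect kV z.
have k0 z y : (0 <= V (z - y)%R)%E by exact: (ker_ge0 kV).
have mTz z s : measurable_fun [set: Rm R] (fun y : Rm R => V (z - T s y)%R).
  exact: (measurableT_comp (mk z) (mT s)).
have C0 := ker_C kV.
have potE z : (potential V nu z = (1 - t)%:E * potential V rho z +
    t%:E * (2^-1%:E * (\int[rho]_y V (z - T 1 y)%R) +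
            2^-1%:E * (\int[rho]_y V (z - T (-1) y)%R)))%E.
  rewrite /Defs.conv nuI// n3I// n1I// n2I//.
  by congr (_ + _ * (_%:E * _ + _))%E; field.
(* The smaller of the gains inside and outside the arc of radius 2 e. *)
pose g := Num.min (eta / 2) (t * (2 * (C * e ^+ 2) * b / 2)).
have g0 : 0 < g.
  by rewrite /g lt_min divr_gt0//= mulr_gt0// divr_gt0// !mulr_gt0// exprn_gt0.
exists nu, g; split => //.
- have F := ae_filter_ringOfSetsType mu; apply: filterS hae => z hz.
  have [zin|zout] := pselect (B2 z).
    apply: (@le_trans _ _ ((1 - t)%:E * (h + eta)%:E)%E).
      by rewrite -EFinM tE lee_fin lerD2l /g ge_min lexx.
    rewrite potE; apply: (@le_trans _ _ ((1 - t)%:E * potential V rho z)%E).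
      by apply: lee_wpmul2l; [rewrite lee_fin subr_ge0|exact: hin].
    rewrite leeDl// mule_ge0 ?lee_fin// ?(ltW t0)//.
    by rewrite adde_ge0// mule_ge0 ?lee_fin ?invr_ge0// integral_ge0.
  rewrite potE; apply: (@averaged_lower_bound _ _ _ _ (2 * (C * e ^+ 2) * b)) => //.
  + by rewrite t0.
  + by rewrite /g ge_min lexx orbT.
  + exact: (potential_ge0 kV).
  + exact: integral_ge0.
  + exact: integral_ge0.
  have c0 : 0 <= 2 * (C * e ^+ 2) by rewrite !mulr_ge0// ?ltW// exprn_gt0.
  have -> : (2 * (C * e ^+ 2) * b)%:E =
      (\int[rho]_y ((2 * (C * e ^+ 2))%:E * (\1_B y)%:E))%E.
    rewrite ge0_integralZl_EFin//; last exact/measurable_EFinP.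
    by rewrite integral_indic// setIT EFinM -bE.
  have m1B : measurable_fun [set: Rm R] (fun y : Rm R => ((2 * (C * e ^+ 2))%:E * (\1_B y)%:E)%E).
    by apply: measurable_funeM; exact/measurable_EFinP.
  have mkk := emeasurable_funD (mk z) (mk z).
  rewrite /Defs.conv -!ge0_integralD//=;
    try by move=> y _; rewrite ?adde_ge0 ?mule_ge0 ?lee_fin.
  apply: ge0_le_integral => //.
  + by move=> y _; rewrite !adde_ge0// mule_ge0 ?lee_fin.
  + exact: emeasurable_funD mkk m1B.
  + exact: emeasurable_funD.
  move=> y _; rewrite /T indicE; case: (boolP (y \in B)) => [|yB]; last first.
    by rewrite !mulr0 addr0 mule0 adde0.
  rewrite inE => -[j yj]; rewrite mule1 mulr1 mulr1 mul1r mulN1r opprD opprB.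
  rewrite addrA (addrCA z e) (addrC e).
  (* If z were within e of a translate of y, which is within e of x, it would lie in [B2]. *)
  apply: kernel_second_difference => // k; apply/negP => zk; apply: zout.
  by exists (j + k); rewrite intrD; lra.
- move=> A [mA pA] hA.
  have TA s : `|s| <= 1 -> T s @^-1` A = A.
    rewrite ler_norml => s1; apply/funext => y; apply/propext.
    rewrite /= /T indicE; case: (boolP (y \in B)) => yB; last by rewrite mulr0 addr0.
    rewrite mulr1; move: yB; rewrite inE => -[j yj].
    have se : - e <= s * e <= e.
      by rewrite -mulN1r; have /andP[sa sb] := s1; rewrite ler_pM2r// sa ler_piMl// ltW.
    have y2 : B2 y by exists j; lra.
    have y2' : B2 (y + s * e) by exists j; lra.
    case: hA => hA; first by split => _; exact: hA.
    by split => H; [have := hA _ y2'|have := hA _ y2] => /(_ H).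
  rewrite nuE n3E n1E n2E !TA ?normrN ?normr1//.
  have : rho A \is a fin_num by exact: fin_num_measure.
  case: (rho A) => // r _; rewrite -!EFinM -!EFinD; congr EFin.
  by field.
Qed.

End gap_sweep.

(** * Smoothing by the second Bernoulli polynomial *)

Section bernoulli.
Context {R : realType}.

(** The periodic Bernoulli polynomial B_2 plus 1/12, a constant that makes it a square. *)
Definition bernoulli2 (z : R) : R := (z - (Num.floor z)%:~R - 1 / 2) ^+ 2.

Lemma bernoulli2_def (z : R) (k : int) : 0 <= z - k%:~R < 1 ->
  bernoulli2 z = (z - k%:~R - 1 / 2) ^+ 2.
Proof.
move=> h; rewrite /bernoulli2 (@floor_def _ _ k)//.
by rewrite intrD; lra.
Qed.

(** The function is the squared distance to the nearest half-integer, a minimum of translated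
    parabolas. Semiconcavity and the Lipschitz bound follow by comparison with the parabola that is
    active at z. *)
Lemma bernoulli2_le (z : R) (k : int) : bernoulli2 z <= (z - k%:~R - 1 / 2) ^+ 2.
Proof.
have [n nz] := floor_fracP z; rewrite (bernoulli2_def nz).
have -> : k = n + (k - n) by rewrite addrC subrK.
move: (k - n) => m; rewrite intrD.
have [->|m0] := eqVneq m 0; first by rewrite addr0.
set r := z - n%:~R in nz *.
rewrite (_ : z - (n%:~R + m%:~R) - 1 / 2 = r - 1 / 2 - m%:~R); last by rewrite /r; ring.
rewrite -subr_ge0 (_ : _ - _ = m%:~R * (m%:~R + 1 - r *+ 2)); last by field.
have [mp|mn] := ltP 0 m.
  have : 1 <= m%:~R :> R by rewrite -[1]/(1%:~R) ler_int.
  by move=> m1; rewrite mulr_ge0//; lra.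
have : m%:~R <= - 1 :> R.
  by rewrite -[-1]/((-1)%:~R) ler_int -ltzD1 addNr lt_neqAle m0.
by move=> m1; rewrite mulr_le0//; lra.
Qed.

Lemma bernoulli2_witness (z : R) :
  exists2 k : int, 0 <= z - k%:~R < 1 & bernoulli2 z = (z - k%:~R - 1 / 2) ^+ 2.
Proof. by have [k kz] := floor_fracP z; exists k => //; exact: bernoulli2_def. Qed.

Lemma bernoulli2_ge0 z : 0 <= bernoulli2 z.
Proof. exact: sqr_ge0. Qed.

Lemma bernoulli2_le1 z : bernoulli2 z <= 1.
Proof. by have [k kz ->] := bernoulli2_witness z; nra. Qed.

Lemma bernoulli2_periodic z : bernoulli2 (z + 1) = bernoulli2 z.
Proof.
have [k kz ->] := bernoulli2_witness z.
rewrite (@bernoulli2_def _ (k + 1)); last by rewrite intrD; lra.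
by rewrite intrD; congr (_ ^+ 2); ring.
Qed.

(** The parabola active at z bounds the function at z + t and z - t, and its second difference is
    exactly 2 t^2. *)
Lemma bernoulli2_semiconcave z t :
  bernoulli2 (z + t) + bernoulli2 (z - t) <= 2 * bernoulli2 z + 2 * t ^+ 2.
Proof.
have [k _ ->] := bernoulli2_witness z.
have := bernoulli2_le (z + t) k; have := bernoulli2_le (z - t) k; nra.
Qed.

Lemma bernoulli2_lip z d : `|d| <= 1 -> bernoulli2 (z + d) <= bernoulli2 z + 2 * `|d|.
Proof.
move=> d1; have [k kz ->] := bernoulli2_witness z.
apply: (le_trans (bernoulli2_le (z + d) k)).
have dd : d ^+ 2 <= `|d| by rewrite -real_normK ?num_real// expr2 ler_piMl.
have := ler_norm d; have := ler_norm (- d); rewrite normrN => h1 h2; nra.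
Qed.

Lemma lipschitz2_continuous (f : R -> R) :
  (forall x d, `|d| <= 1 -> f (x + d) <= f x + 2 * `|d|) -> continuous f.
Proof.
move=> lipf z; apply/cvgrPdist_lt => e e0; apply/nbhs_ballP.
exists (Num.min 1 (e / 2)); first by rewrite /= lt_min ltr01 divr_gt0.
move=> y; rewrite /ball/= lt_min => /andP[/ltW y1 y2].
have h1 : f y <= f z + 2 * `|z - y|.
  by rewrite -{1}(subrKC z y) (distrC z) lipf// distrC.
have h2 : f z <= f y + 2 * `|z - y|.
  by rewrite -{1}(subrKC y z) lipf.
by rewrite ltr_distlC; lra.
Qed.

Lemma bernoulli2_continuous : continuous bernoulli2.
Proof. exact: lipschitz2_continuous bernoulli2_lip. Qed.

(** Two branches merge into one formula in which the kink at 0 is the term -|z|. *)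
Lemma bernoulli2E z : `|z| <= 1 -> bernoulli2 z = z ^+ 2 - `|z| + 1 / 4.
Proof.
rewrite ler_norml => z1.
have [z0|z0] := ltP z 0.
  rewrite (@bernoulli2_def _ (-1)) ?ltr0_norm//; last by rewrite mulrN1z; lra.
  by rewrite mulrN1z; field.
rewrite ger0_norm//; have [->|zn1] := eqVneq z 1.
  by rewrite (@bernoulli2_def _ 1); [field|lra].
have zlt1 : z < 1 by rewrite lt_neqAle zn1; lra.
by rewrite (@bernoulli2_def _ 0); [field|lra].
Qed.

(* Second differences of [bernoulli2] detect arcs because its distributional second derivative is 2 minus twice the Dirac comb. *)
Lemma bernoulli2_second_difference s t y : 0 <= s -> s < t -> t <= 1 / 2 ->
  bernoulli2 (t - y) + bernoulli2 (- t - y)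
    + 2 * (t - s) * \1_(Tarc (- s) (2 * s)) y
  <= bernoulli2 (s - y) + bernoulli2 (- s - y) + 2 * (t ^+ 2 - s ^+ 2).
Proof.
move=> s0 st t2.
have Bk (k : int) z : bernoulli2 z = bernoulli2 (z - k%:~R).
  by rewrite -mulrNz (periodic_intr bernoulli2_periodic).
have core (u : R) : `|u| <= 1 / 2 -> 
  bernoulli2 (t - u) + bernoulli2 (- t - u) + (if `|u| <= s then 2 * (t - s) else 0)
  <= bernoulli2 (s - u) + bernoulli2 (- s - u) + 2 * (t ^+ 2 - s ^+ 2).
  move=> u2; have := u2; rewrite ler_norml => u2'.
  rewrite !bernoulli2E; [|by rewrite ler_norml; lra ..].
  have sq : (t - u) ^+ 2 + (- t - u) ^+ 2 = (s - u) ^+ 2 + (- s - u) ^+ 2 + 2 * (t ^+ 2 - s ^+ 2).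
    by ring.
  (* Only the absolute values are left to compare: |t - u| + |t + u| is at least 2 max(t, |u|),
     while the same sum for s equals 2 max(s, |u|). *)
  have n1 : 2 * t <= `|t - u| + `|- t - u|.
    by have := ler_norm (t - u); have := ler_norm (- (- t - u)); rewrite normrN; lra.
  have n2 : 2 * `|u| <= `|t - u| + `|- t - u|.
    have := ler_norm (t - u); have := ler_norm (- (- t - u)); have := ler_norm (- (t - u)).
    have := ler_norm (- t - u); rewrite !normrN.
    by have [u0|u0] := ger0P u; lra.
  case: ifPn => us.
    have us' := us; rewrite ler_norml in us'.
    rewrite (@ger0_norm _ (s - u)); last lra.
    rewrite (@ler0_norm _ (- s - u)); last lra.
    lra.
  rewrite -ltNge in us.
  have n3 : `|s - u| + `|- s - u| = 2 * `|u|.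
    move: us; have [u0|u0] := ger0P u => us.
      rewrite (@ler0_norm _ (s - u)); last lra.
      by rewrite (@ler0_norm _ (- s - u)); [ring|lra].
    rewrite (@ger0_norm _ (s - u)); last lra.
    by rewrite (@ger0_norm _ (- s - u)); [ring|lra].
  lra.
have shift (k : int) : `|y + k%:~R| <= 1 / 2 ->
  bernoulli2 (t - y) + bernoulli2 (- t - y) + (if `|y + k%:~R| <= s then 2 * (t - s) else 0)
  <= bernoulli2 (s - y) + bernoulli2 (- s - y) + 2 * (t ^+ 2 - s ^+ 2).
  move=> /core; rewrite (Bk k (t - y)) (Bk k (- t - y)) (Bk k (s - y)) (Bk k (- s - y)).
  by rewrite !opprD !addrA.
rewrite indicE; case: (boolP (y \in _)) => /= [|yI].
  rewrite inE => -[k yk]; rewrite mulr1.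
  have yk' : `|y + k%:~R| <= s by rewrite ler_norml; lra.
  have := shift k; rewrite yk'; apply; lra.
(* The representative y - k lies in [-1/2, 1/2[, and the extra term of [core] is nonnegative in
   either case. *)
rewrite mulr0 addr0; have [k ky] := floor_fracP (y + 1 / 2).
have := shift (- k); rewrite mulrNz; set v := `|_| => hv.
have : v <= 1 / 2 by rewrite /v ler_norml; lra.
by move=> /hv; case: ifPn => // _; lra.
Qed.

End bernoulli.

Section smoothed.
Context {R : realType} (rho : probability (Rm R) R).

Lemma integrable_bounded (g : R -> R) (K : R) :
  measurable_fun [set: Rm R] g -> (forall y, 0 <= g y <= K) ->
  rho.-integrable setT (EFin \o g).
Proof.
move=> mg gK; apply/integrableP; split; first exact/measurable_EFinP.
apply: (@le_lt_trans _ _ (\int[rho]_y (cst K%:E y))%E).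
  apply: ge0_le_integral => //=.
  - by apply/measurable_EFinP; exact: measurableT_comp.
  - by move=> y _; rewrite lee_fin ger0_norm; have := gK y; lra.
by rewrite integral_cst//= probability_setT mule1 ltry.
Qed.

(* Up to constants [bernoulli2] is the Green function of the Laplacian on R/Z: the
   measure can be recovered from its smoothing. *)
Definition smoothed (x : R) : R := (\int[rho]_y (bernoulli2 (x - y)))%R.

Lemma measurable_bernoulli2 : measurable_fun [set: Rm R] (@bernoulli2 R : Rm R -> R).
Proof. exact: continuous_measurable_fun (@bernoulli2_continuous R). Qed.

Lemma measurable_bernoulli2_reflect x :
  measurable_fun [set: Rm R] (fun y : Rm R => bernoulli2 (x - y)).
Proof. exact: measurableT_comp measurable_bernoulli2 (measurable_reflect x). Qed.

Lemma integrable_bernoulli2 x :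
  rho.-integrable setT (EFin \o (fun y => bernoulli2 (x - y))).
Proof.
apply: (@integrable_bounded _ 1); first exact: measurable_bernoulli2_reflect.
by move=> y; rewrite bernoulli2_ge0 bernoulli2_le1.
Qed.

Lemma smoothedE x : (\int[rho]_y (bernoulli2 (x - y))%:E)%E = (smoothed x)%:E.
Proof.
rewrite /smoothed /Rintegral fineK//.
exact: (integrable_fin_num measurableT (integrable_bernoulli2 x)).
Qed.

Lemma smoothed_ge0 x : 0 <= smoothed x.
Proof. by apply: Rintegral_ge0 => y _; exact: bernoulli2_ge0. Qed.

Lemma smoothed_le1 x : smoothed x <= 1.
Proof.
have -> : 1 = \int[rho]_y 1 :> R.
  by rewrite Rintegral_cst//= probability_setT /= mulr1.
apply: le_Rintegral => //; first exact: integrable_bernoulli2.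
- by apply: (@integrable_bounded _ 1) => // y; rewrite ler01 lexx.
- by move=> y _; exact: bernoulli2_le1.
Qed.

Lemma smoothed_periodic x : smoothed (x + 1) = smoothed x.
Proof.
apply: eq_Rintegral => y _; rewrite -[RHS]bernoulli2_periodic; congr bernoulli2; ring.
Qed.

Lemma smoothed_semiconcave x t :
  smoothed (x + t) + smoothed (x - t) <= 2 * smoothed x + 2 * t ^+ 2.
Proof.
have i0 := integrable_bernoulli2 x.
rewrite /smoothed -RintegralD//; [|exact: integrable_bernoulli2..].
rewrite -RintegralZl//.
have i1 : rho.-integrable setT (EFin \o (fun y => 2 * bernoulli2 (x - y))).
  exact: (integrableZl measurableT 2 i0).
have i2 : rho.-integrable setT (EFin \o (fun=> 2 * t ^+ 2)).
  apply: (@integrable_bounded _ (2 * t ^+ 2)) => // y.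
  by rewrite lexx mulr_ge0 ?sqr_ge0.
have -> : 2 * t ^+ 2 = \int[rho]_y (2 * t ^+ 2).
  by rewrite Rintegral_cst//= probability_setT /= mulr1.
rewrite -RintegralD//; apply: le_Rintegral => //.
- exact: (integrableD measurableT (integrable_bernoulli2 _) (integrable_bernoulli2 _)).
- exact: (integrableD measurableT i1 i2).
- move=> y _; have := bernoulli2_semiconcave (x - y) t.
  by rewrite (addrAC x t) (addrAC x (- t)).
Qed.

Lemma smoothed_lip x d : `|d| <= 1 -> smoothed (x + d) <= smoothed x + 2 * `|d|.
Proof.
move=> d1.
have i0 := integrable_bernoulli2 x.
have i2 : rho.-integrable setT (EFin \o (fun=> 2 * `|d|)).
  apply: (@integrable_bounded _ (2 * `|d|)) => // y.
  by rewrite lexx mulr_ge0.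
have -> : 2 * `|d| = \int[rho]_y (2 * `|d|).
  by rewrite Rintegral_cst//= probability_setT /= mulr1.
rewrite /smoothed -RintegralD//; apply: le_Rintegral => //.
- exact: integrable_bernoulli2.
- exact: (integrableD measurableT i0 i2).
- by move=> y _; rewrite (addrAC x d); exact: bernoulli2_lip.
Qed.

Lemma smoothed_continuous : continuous smoothed.
Proof. exact: lipschitz2_continuous smoothed_lip. Qed.

Lemma measurable_smoothed : measurable_fun [set: Rm R] (smoothed : Rm R -> R).
Proof. exact: continuous_measurable_fun smoothed_continuous. Qed.

Lemma smoothed_min : exists x0, forall x, smoothed x0 <= smoothed x.
Proof.
have [|c _ cmin] := @EVT_min R smoothed 0 1 ler01.
  by apply: continuous_subspaceT => x; exact: smoothed_continuous.
exists c => x; have [k kx] := floor_fracP x.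
have -> : smoothed x = smoothed (x - k%:~R).
  by rewrite -mulrNz (periodic_intr smoothed_periodic).
by apply: cmin; rewrite in_itv/=; lra.
Qed.

(** Integrating [bernoulli2_second_difference] against rho, the constant values cancel and 2 (t - s)
    rho(I) <= 2 (t^2 - s^2) remains, that is rho(I) <= t + s for every t slightly above s. *)
Lemma constant_smoothed_arc_le m s : (forall x, smoothed x = m) ->
  0 <= s < 1 / 2 -> (rho (Tarc (- s) (2 * s)) <= (2 * s)%:E)%E.
Proof.
move=> fm s2; have [s0 s1] : 0 <= s /\ s < 1 / 2 by lra.
set I := Tarc _ _.
have mI : measurable (I : set (Rm R)) by exact: measurable_Tarc.
have rI : rho I \is a fin_num by exact: fin_num_measure.
have key t : s < t -> t <= 1 / 2 -> fine (rho I) <= t + s.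
  move=> st t2; have ts : 0 < 2 * (t - s) by lra.
  pose c := 2 * (t ^+ 2 - s ^+ 2).
  have c0 : 0 <= c by rewrite /c; nra.
  have iB := integrable_bernoulli2.
  have i1 : rho.-integrable setT (EFin \o (fun y => 2 * (t - s) * \1_I y)).
    apply: (@integrable_bounded _ (2 * (t - s))).
      by apply: measurable_funM => //.
    by move=> y; rewrite indicE; case: (y \in I); rewrite ?mulr1 ?mulr0 ?lexx ltW.
  have i2 : rho.-integrable setT (EFin \o (fun=> c)).
    by apply: (@integrable_bounded _ c) => // y; rewrite lexx c0.
  have : \int[rho]_y (bernoulli2 (t - y) + bernoulli2 (- t - y) + 2 * (t - s) * \1_I y)
    <= \int[rho]_y (bernoulli2 (s - y) + bernoulli2 (- s - y) + c).
    apply: le_Rintegral => //.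
    - exact: (integrableD measurableT (integrableD measurableT (iB _) (iB _)) i1).
    - exact: (integrableD measurableT (integrableD measurableT (iB _) (iB _)) i2).
    - by move=> y _; exact: bernoulli2_second_difference.
  have iDB a b := integrableD measurableT (iB a) (iB b).
  rewrite RintegralD//; [|exact: iDB].
  rewrite RintegralD//; [|exact: iB..].
  rewrite RintegralD//; [|exact: iDB].
  rewrite RintegralD//; [|exact: iB..].
  rewrite -!/(smoothed _) !fm Rintegral_cst//= probability_setT /= mulr1.
  rewrite RintegralZl//; last first.
    apply: (@integrable_bounded _ 1) => //.
    by move=> y; rewrite indicE; case: (y \in I); rewrite ?lexx ?ler01.
  have -> : \int[rho]_y \1_I y = fine (rho I).
    by rewrite /Rintegral integral_indic// setIT.
  rewrite /c => H; have : (t - s) * fine (rho I) <= (t - s) * (t + s) by nra.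
  by rewrite ler_pM2l; lra.
rewrite -(fineK rI) lee_fin leNgt; apply/negP => H.
(* In effect min(1/2, rho(I)/2), which exceeds s; then rho(I) <= t + s < 2 t <= rho(I). *)
pose t := Num.min (1 / 2) ((s + fine (rho I) - s) / 2).
have t1 : s < t by rewrite /t lt_min; lra.
have t2 : t <= 1 / 2 by rewrite /t ge_min lexx.
have t3 : t <= fine (rho I) / 2 by rewrite /t ge_min; lra.
by have := key t t1 t2; lra.
Qed.

End smoothed.

(** * Measures of constant potential are uniform *)

Section max_principle.
Context {R : realType} (V : R -> \bar R) (C : R).
Hypothesis kV : kernel_spec V C.
Variable rho : probability (Rm R) R.
Local Notation mu := (@lebesgue_measure R).
Local Notation f := (smoothed rho).
Local Notation unit_itv := (`[0%R, 1%R]%classic).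

(** The flag i marks points near the pole. Away from it, convexity applies; near it, the weight e is
    at most 2 t^2, and the two added terms absorb the left-hand side. *)
Lemma kernel_second_difference_le (x t e : R) (i : bool) : 0 < t -> 0 <= e ->
  (~~ i -> forall k : int, ~~ (- t <= x + k%:~R <= t)) -> (i -> e <= 2 * t ^+ 2) ->
  (V x * e%:E + V x * e%:E + (2 * (C * t ^+ 2) * e)%:E <=
   V (x - t)%R * e%:E + V (x + t)%R * e%:E +
   ((4 * t ^+ 2)%:E * (V x * i%:R%:E) + (4 * (C * t ^+ 4))%:E))%E.
Proof.
move=> t0 e0 hi0 hi1; have C0 := ltW (ker_C kV).
have t20 : 0 <= t ^+ 2 by exact: sqr_ge0.
case: i hi0 hi1 => /= [_ /(_ isT) e2|/(_ isT) h _].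
  rewrite mule1 -[leLHS]add0e; apply: leeD.
    by rewrite adde_ge0// mule_ge0 ?lee_fin// (ker_ge0 kV).
  apply: leeD.
    rewrite -ge0_muleDr ?lee_fin// muleC; apply: lee_wpmul2r; first exact: (ker_ge0 kV).
    by rewrite -EFinD lee_fin; lra.
  rewrite lee_fin (_ : 4 * (C * t ^+ 4) = 2 * (C * t ^+ 2) * (2 * t ^+ 2)); last by ring.
  by apply: ler_wpM2l => //; rewrite mulr_ge0// mulr_ge0.
rewrite !mule0 add0e.
apply: (@le_trans _ _ (V (x - t)%R * e%:E + V (x + t)%R * e%:E)%E); last first.
  by rewrite leeDl// lee_fin mulr_ge0// mulr_ge0// exprn_ge0// ltW.
rewrite EFinM -!ge0_muleDl ?(ker_ge0 kV)//; last first.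
- by rewrite lee_fin mulr_ge0// mulr_ge0.
- by rewrite adde_ge0// (ker_ge0 kV).
apply: lee_wpmul2r; first by rewrite lee_fin.
exact: kernel_second_difference.
Qed.

Variable h : R.
Hypothesis h0 : 0 <= h.
Hypothesis hae : (\forall x \ae mu, potential V rho x = h%:E)%E.

Let mB := @measurable_bernoulli2 R.
Let B0 (x : R) : (0 <= (bernoulli2 x)%:E)%E.
Proof. by rewrite lee_fin bernoulli2_ge0. Qed.
Let V0 := ker_ge0 kV.

(** Convolutions commute: V * (B * rho) = B * (V * rho), with B for [bernoulli2]. The potential is
    now integrated against Lebesgue measure, so its value h almost everywhere suffices. *)
Lemma integral_kernel_smoothed x :
  (\int[mu]_(w in unit_itv) (V (x - w)%R * (f w)%:E) =
   h%:E * \int[mu]_(w in unit_itv) (bernoulli2 w)%:E)%E.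
Proof.
have mBr (y : R) : measurable_fun [set: Rm R] (fun w : Rm R => (bernoulli2 (y - w))%:E).
  by apply/measurable_EFinP; exact: measurable_bernoulli2_reflect.
transitivity (\int[mu]_(w in unit_itv) \int[rho]_z (V (x - w)%R * (bernoulli2 (w - z))%:E))%E.
  apply: eq_integral => w _; by rewrite -smoothedE ge0_integralZl.
have mBd : measurable_fun [set: Rm R * Rm R] (fun z : Rm R * Rm R => (bernoulli2 (z.1 - z.2))%:E).
  apply/measurable_EFinP; apply: (measurableT_comp mB); exact: measurable_funB.
rewrite (tonelli_unit_interval rho (F := fun w z => (V (x - w)%R * (bernoulli2 (w - z))%:E)%E)); last 2 first.
- apply: emeasurable_funM => //.
  exact: (measurableT_comp (measurable_kernel_reflect kV x) measurable_fst).
- by move=> *; rewrite mule_ge0.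
transitivity (\int[rho]_z \int[mu]_(w in unit_itv) (V (w - z)%R * (bernoulli2 (x - w))%:E))%E.
  (* The reflection w -> x + z - w exchanges the arguments of V and [bernoulli2]. *)
  apply: eq_integral => z _.
  rewrite -[RHS](ge0_integral_period_reflect (x + z)).
  - apply: eq_integral => w _; congr (V _ * (bernoulli2 _)%:E)%E; ring.
  - apply: emeasurable_funM.
      by apply: (measurableT_comp (ker_measurable kV)); exact: measurable_funB.
    exact: mBr.
  - by move=> w; rewrite mule_ge0.
  - move=> w; congr (_ * _%:E)%E.
      by rewrite -[RHS](ker_per kV); congr V; ring.
    by rewrite -[LHS]bernoulli2_periodic; congr bernoulli2; ring.
rewrite -(tonelli_unit_interval rho (F := fun w z => (V (w - z)%R * (bernoulli2 (x - w))%:E)%E)); last 2 first.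
- apply: emeasurable_funM; first exact: (measurable_kernel_diff kV).
  exact: (measurableT_comp (mBr x) measurable_fst).
- by move=> *; rewrite mule_ge0.
transitivity (\int[mu]_(w in unit_itv) (h%:E * (bernoulli2 (x - w))%:E))%E.
  apply: ge0_ae_eq_integral => //.
  - apply: measurable_funTS; rewrite (_ : (fun w => _) = (fun w => potential V rho w * (bernoulli2 (x - w))%:E)%E).
      by apply: emeasurable_funM => //; exact: (measurable_potential kV).
    apply/funext => w; rewrite ge0_integralZr//; exact: measurable_kernel_reflect kV w.
  - by apply: measurable_funTS; exact: measurable_funeM.
  - by move=> w _; apply: integral_ge0 => z _; rewrite mule_ge0.
  - by move=> w _; rewrite mule_ge0// lee_fin.
  - have F := ae_filter_ringOfSetsType mu; apply: filterS hae => w hw _.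
    by rewrite ge0_integralZr ?[X in (X * _)%E]hw//; exact: measurable_kernel_reflect kV w.
rewrite ge0_integralZl_EFin//; last by apply: measurable_funTS.
congr (_ * _)%E; apply: (ge0_integral_period_reflect x (f := fun w => (bernoulli2 w)%:E)) => //.
- exact/measurable_EFinP.
- by move=> w; rewrite bernoulli2_periodic.
Qed.

Lemma unit_integral_le1 (g : R -> R) : measurable_fun [set: Rm R] (g : Rm R -> _) ->
  (forall w, 0 <= g w <= 1) ->
  (\int[mu]_(w in unit_itv) (g w)%:E <= 1)%E.
Proof.
move=> mg g01.
have -> : (1 = \int[mu]_(w in unit_itv) (cst 1 w))%E.
  by rewrite integral_cst//= lebesgue_measure_itv/= lte_fin ltr01 oppr0 adde0 mule1.
apply: ge0_le_integral => //.
- by move=> w _; rewrite lee_fin; have /andP[] := g01 w.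
- by apply: measurable_funTS; exact/measurable_EFinP.
- by move=> w _; rewrite lee_fin; have /andP[] := g01 w.
Qed.

Lemma unit_integral_fin_num (g : R -> R) : measurable_fun [set: Rm R] (g : Rm R -> _) ->
  (forall w, 0 <= g w <= 1) ->
  (\int[mu]_(w in unit_itv) (g w)%:E)%E \is a fin_num.
Proof.
move=> mg g01; rewrite ge0_fin_numE.
  by rewrite (le_lt_trans (unit_integral_le1 mg g01))// ltry.
by apply: integral_ge0 => w _; rewrite lee_fin; have /andP[] := g01 w.
Qed.

Lemma small_arc_excludes (w t : R) :
  0 < w < 1 -> t < w -> t < 1 - w -> ~ Tarc (- t) (2 * t) w.
Proof.
move=> w01 n1 n2 [k]; have [k0|k0] := leP 0 k.
  have : 0 <= k%:~R :> R by rewrite ler0z.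
  lra.
have : k%:~R <= - 1 :> R by rewrite -[-1]/((-1)%:~R) ler_int -ltzD1 addNr.
lra.
Qed.

(** Dominated convergence with bound V. The points 0 and 1 lie in all the arcs, so they are removed
    first; every other point of the period eventually leaves the arcs. *)
Lemma kernel_near0_cvg0 :
  (\int[mu]_(w in unit_itv)
     (V w * (\1_(Tarc (- n.+1%:R^-1) (2 * n.+1%:R^-1)) w)%:E) @[n --> \oo] --> 0)%E.
Proof.
pose N (n : nat) : set R := Tarc (- n.+1%:R^-1) (2 * n.+1%:R^-1).
have mVN n : measurable_fun [set: Rm R] (fun w : Rm R => V w * (\1_(N n) w)%:E)%E.
  apply: emeasurable_funM; first exact: (ker_measurable kV).
  have mNn : measurable (N n : set (Rm R)) by exact: measurable_Tarc.
  exact/measurable_EFinP.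
have E n : (\int[mu]_(w in unit_itv) (V w * (\1_(N n) w)%:E) =
  \int[mu]_(w in `]0%R, 1%R[) (V w * (\1_(N n) w)%:E))%E.
  rewrite -integral_itv_bndo_bndc; last by apply: measurable_funTS; exact: mVN.
  by rewrite -integral_itv_obnd_cbnd//; apply: measurable_funTS; exact: mVN.
under eq_fun do rewrite E.
have iV1 : mu.-integrable (unit_itv : set (Rm R)) (V : Rm R -> \bar R).
  apply/integrableP; split; first exact: measurable_funTS (ker_measurable kV).
  by under eq_integral do rewrite gee0_abs//; exact: (ker_int kV).
have iV : mu.-integrable (`]0%R, 1%R[%classic : set (Rm R)) (V : Rm R -> \bar R).
  apply: integrableS iV1; [exact: measurable_itv..|].
  by move=> x /=; rewrite !in_itv/=; lra.
have mD : measurable (`]0%R, 1%R[%classic : set (Rm R)) by exact: measurable_itv.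
have [|||||_ _] := @dominated_convergence _ _ _ mu `]0%R, 1%R[%classic mD
  (fun n w => V w * (\1_(N n) w)%:E)%E (cst 0%E) V.
- by move=> n; apply: measurable_funTS; exact: mVN.
- by [].
- apply: aeW => w /=; rewrite in_itv/= => w01.
  apply: cvg_near_cst.
  have m0 : 0 < Num.min w (1 - w) by rewrite lt_min; lra.
  have := near_infty_natSinv_lt (PosNum m0); apply: filterS => n /=.
  rewrite lt_min => /andP[n1 n2]; rewrite indicE.
  case: (boolP (w \in N n)) => [|_]; last by rewrite mule0.
  by rewrite inE => wN; case: (@small_arc_excludes w _ w01 n1 n2 wN).
- exact: iV.
- apply: aeW => w n _; rewrite gee0_abs ?mule_ge0 ?lee_fin//.
  rewrite -[leRHS]mule1; apply: lee_wpmul2l => //.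
  by rewrite lee_fin indicE lern1 leq_b1.
by rewrite integral0.
Qed.

(* Let e be f minus its minimum. The second difference at the minimizer of the
   constant function V * e is at least 2 C t^2 times the mass of e, up to the
   contribution of the pole of V, where e = O(t^2). *)
Lemma smoothed_constant : exists m, forall x, f x = m.
Proof.
have [x0 fmin] := smoothed_min rho; exists (f x0).
pose e w := f w - f x0.
have e0 w : 0 <= e w by rewrite subr_ge0.
have e1 w : e w <= 1.
  by rewrite /e lerBlDr (le_trans (smoothed_le1 rho w))// lerDl smoothed_ge0.
have me' : measurable_fun [set: Rm R] (e : Rm R -> _).
  apply: measurable_funB => //.
  exact: (measurable_smoothed rho).
have me : measurable_fun [set: Rm R] (fun w : Rm R => (e w)%:E) by exact/measurable_EFinP.
have eper w : e (w + 1) = e w by rewrite /e smoothed_periodic.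
have mkr (x : R) := measurable_kernel_reflect kV x.
have mVe x : measurable_fun [set: Rm R] (fun w : Rm R => V (x - w)%R * (e w)%:E)%E.
  exact: emeasurable_funM.
have Ve0 x w : (0 <= V (x - w)%R * (e w)%:E)%E by rewrite mule_ge0// lee_fin.
pose phi x := (\int[mu]_(w in unit_itv) (V (x - w)%R * (e w)%:E))%E.
(* V * f is constant, and V convolved with the constant f x0 is f x0 times the integral of V; hence
   V * e is constant. *)
have phiE x : (phi x + (f x0)%:E * \int[mu]_(w in unit_itv) V w =
     h%:E * \int[mu]_(w in unit_itv) (bernoulli2 w)%:E)%E.
  rewrite -(integral_kernel_smoothed x).
  rewrite -(ge0_integral_period_reflect x (ker_measurable kV) V0 (ker_per kV)).
  rewrite -ge0_integralZl_EFin ?smoothed_ge0//; last exact: measurable_funTS.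
  rewrite /phi -ge0_integralD//.
  - apply: eq_integral => w _; rewrite [X in (_ + X)%E]muleC -ge0_muleDr ?lee_fin ?smoothed_ge0//.
    by rewrite -EFinD /e subrK.
  - exact: measurable_funTS.
  - by move=> w _; rewrite mule_ge0// lee_fin smoothed_ge0.
  - by apply: measurable_funTS; exact: measurable_funeM.
have muI : mu unit_itv = 1%E.
  by rewrite lebesgue_measure_itv/= lte_fin ltr01 oppr0 adde0.
have Bfin : (\int[mu]_(w in unit_itv) (bernoulli2 w)%:E)%E \is a fin_num.
  by apply: unit_integral_fin_num => // w; rewrite bernoulli2_ge0 bernoulli2_le1.
have vfin := integral_kernel_fin kV.
pose v := fine (\int[mu]_(w in unit_itv) V w)%E.
have vE : (\int[mu]_(w in unit_itv) V w)%E = v%:E by rewrite /v fineK.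
pose ph := h * fine (\int[mu]_(w in unit_itv) (bernoulli2 w)%:E)%E - f x0 * v.
have phE x : phi x = ph%:E.
  have := phiE x; rewrite vE -(fineK Bfin) -!EFinM.
  case: (phi x) => [r| |] //=; rewrite -EFinD => -[hr]; congr EFin.
  by rewrite /ph -hr; ring.
pose S := (\int[mu]_(w in unit_itv) (e w)%:E)%E.
have Sfin : S \is a fin_num by apply: unit_integral_fin_num => // w; rewrite e0 e1.
pose s := fine S.
have sE : S = s%:E by rewrite /s fineK.
pose N (t : R) : set R := Tarc (- t) (2 * t).
pose a (t : R) := (\int[mu]_(w in unit_itv) (V w * (\1_(N t) w)%:E))%E.
have mN t : measurable (N t : set (Rm R)) by exact: measurable_Tarc.
have mVN t : measurable_fun [set: Rm R] (fun w : Rm R => V w * (\1_(N t) w)%:E)%E.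
  apply: emeasurable_funM; first exact: (ker_measurable kV).
  have mNt := mN t; exact/measurable_EFinP.
have VN0 t w : (0 <= V w * (\1_(N t) w)%:E)%E by rewrite mule_ge0// lee_fin.
have NP t w : N t w -> exists k : int, - t <= w + k%:~R <= t.
  by move=> [k hk]; exists k; lra.
(* The values of [phi] cancel in its second difference; dividing by 2 t^2 leaves this bound, where a
   t is the integral of V near its pole. *)
have main t : 0 < t -> ((C * s)%:E <= 2%:E * a t + (2 * (C * t ^+ 2))%:E)%E.
  move=> t0.
  have aE : a t = (\int[mu]_(w in unit_itv) (V (x0 - w)%R * (\1_(N t) (x0 - w))%:E))%E.
    rewrite /a -(ge0_integral_period_reflect x0 (f := fun w => (V w * (\1_(N t) w)%:E)%E))//.
      exact: mVN.
    move=> w; rewrite (ker_per kV) !indicE; congr (_ * (_ : bool)%:R%:E)%E.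
    have [_ Np] := Tset_Tarc (- t) (2 * t).
    by apply/idP/idP; rewrite !inE; apply Np.
  have mVN' : measurable_fun [set: Rm R] (fun w : Rm R => V (x0 - w)%R * (\1_(N t) (x0 - w))%:E)%E.
    exact: measurableT_comp (mVN t) (measurable_reflect x0).
  have C0 := ker_C kV.
  have t20 : 0 < t ^+ 2 by rewrite exprn_gt0.
  pose g1 w := (V (x0 - w)%R * (e w)%:E + V (x0 - w)%R * (e w)%:E)%E.
  pose g2 w := (2 * (C * t ^+ 2) * e w)%:E.
  pose g3 w := (V (x0 - t - w)%R * (e w)%:E + V (x0 + t - w)%R * (e w)%:E)%E.
  pose g4 w := ((4 * t ^+ 2)%:E * (V (x0 - w)%R * (\1_(N t) (x0 - w))%:E))%E.
  pose K := (4 * (C * t ^+ 4))%:E.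
  have c2 : 0 <= 2 * (C * t ^+ 2) by rewrite !mulr_ge0// ltW.
  have c4 : 0 <= 4 * t ^+ 2 by rewrite mulr_ge0// ltW.
  have K0 : (0 <= K)%E by rewrite lee_fin !mulr_ge0// ?exprn_ge0// ltW.
  have mg1 : measurable_fun [set: Rm R] (g1 : Rm R -> _) by exact: emeasurable_funD.
  have mg2 : measurable_fun [set: Rm R] (g2 : Rm R -> _).
    by apply/measurable_EFinP; exact: measurable_funM.
  have mg3 : measurable_fun [set: Rm R] (g3 : Rm R -> _) by exact: emeasurable_funD.
  have mg4 : measurable_fun [set: Rm R] (g4 : Rm R -> _) by exact: measurable_funeM.
  have g10 w : (0 <= g1 w)%E by rewrite adde_ge0.
  have g20 w : (0 <= g2 w)%E by rewrite lee_fin mulr_ge0.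
  have g30 w : (0 <= g3 w)%E by rewrite adde_ge0.
  have g40 w : (0 <= g4 w)%E by rewrite mule_ge0 ?lee_fin// mule_ge0// lee_fin.
  have mgK : measurable_fun [set: Rm R] (fun w : Rm R => g4 w + K)%E by exact: emeasurable_funD.
  have : (\int[mu]_(w in unit_itv) (g1 w + g2 w) <=
          \int[mu]_(w in unit_itv) (g3 w + (g4 w + K)))%E.
    apply: ge0_le_integral => //.
    - by move=> w _; rewrite adde_ge0.
    - by apply: measurable_funTS; exact: emeasurable_funD.
    - by apply: measurable_funTS; exact: emeasurable_funD.
    - move=> w _; rewrite /g3 (addrAC x0 (- t)) (addrAC x0 t) /g4 indicE.
      apply: kernel_second_difference_le => //.
      + rewrite notin_setE => hN k; apply/negP => hk; apply: hN.
        by exists k; lra.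
      + rewrite inE => /NP[k hk].
        set d := x0 - w + k%:~R in hk.
        have -> : e w = f (x0 - d) - f x0.
          rewrite /e -(periodic_intr (smoothed_periodic rho) k (x0 - d)).
          by congr (f _ - _); rewrite /d; ring.
        (* Semiconcavity and minimality give f (x0 - d) <= 2 f x0 + 2 d^2 - f (x0 + d) <= f x0 + 2
           d^2, with |d| <= t. *)
        have := smoothed_semiconcave rho x0 d; have := fmin (x0 + d).
        have : d ^+ 2 <= t ^+ 2 by rewrite -(real_normK (num_real d)) lerXn2r ?nnegrE ?ler_norml// ltW.
        lra.
  have T1 D (g : R -> \bar R) : measurable_fun [set: Rm R] (g : Rm R -> _) -> measurable_fun D g.
    by exact: measurable_funTS.
  rewrite ge0_integralD//; [|exact: T1..].
  rewrite [X in (_ <= X)%E -> _]ge0_integralD//; [|exact: T1|by move=> w _; rewrite adde_ge0|exact: T1].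
  rewrite [X in (_ <= _ + X)%E -> _]ge0_integralD//; [|exact: T1].
  rewrite ge0_integralD//; [|exact: T1..].
  rewrite [X in (_ <= X + _)%E -> _]ge0_integralD//; [|exact: T1..].
  rewrite -!/(phi _) !phE.
  rewrite (_ : \int[mu]_(w in unit_itv) g2 w = (2 * (C * t ^+ 2) * s)%:E)%E; last first.
    transitivity (\int[mu]_(w in unit_itv) ((2 * (C * t ^+ 2))%:E * (e w)%:E))%E.
      by apply: eq_integral.
    rewrite ge0_integralZl_EFin//; last exact: T1.
      by rewrite -/S sE.
    by move=> w _; rewrite lee_fin.
  rewrite (_ : \int[mu]_(w in unit_itv) g4 w = (4 * t ^+ 2)%:E * a t)%E; last first.
    rewrite aE -ge0_integralZl_EFin//; last exact: T1.
  rewrite [X in (_ <= _ + (_ + X))%E -> _](_ : _ = K); last first.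
    by rewrite integral_cst//= [X in (_ * X)%E]muI mule1.
  have : (0 <= a t)%E by apply: integral_ge0.
  case: (a t) => [r| |] //= r0; last by move=> _; rewrite gt0_muley ?lte_fin// addye ?leey.
  rewrite -!EFinM -!EFinD !lee_fin => H.
  have {}H : t ^+ 2 * (C * s) <= t ^+ 2 * (2 * r + 2 * (C * t ^+ 2)).
    have e4 : t ^+ 4 = t ^+ 2 * t ^+ 2 by ring.
    by move: H; rewrite e4; set T2 := t ^+ 2; lra.
  by rewrite ler_pM2l in H.
have s_le0 : s <= 0.
  have C0 := ker_C kV.
  suff : ((C * s)%:E <= 0)%E by rewrite lee_fin pmulr_rle0.
  have L : (2%:E * a (n.+1%:R^-1)%R + (2 * (C * n.+1%:R^-1 ^+ 2))%:E @[n --> \oo] --> 0)%E.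
    rewrite [X in _ --> X](_ : 0 = 2%:E * 0 + (2 * (C * 0 ^+ 2))%:E)%E; last first.
      by rewrite mule0 expr0n/= !mulr0 adde0.
    apply: cvgeD => //; first by apply: cvgeZl => //; exact: kernel_near0_cvg0.
    apply: cvg_EFin; first exact: nearW.
    apply: cvgMr; apply: cvgMr.
    by rewrite expr2; under eq_fun do rewrite expr2; apply: cvgM; exact: cvg_harmonic.
  rewrite -(cvg_lim _ L)//; apply: lime_ge; first by apply/cvg_ex; exists 0%E.
  by apply: nearW => n; apply: main.
move=> w1; apply/eqP; rewrite eq_le fmin andbT leNgt; apply/negP => w1lt.
have ew1 : 0 < e w1 by rewrite subr_gt0.
(* The Lipschitz constant 2 keeps e above e w1 / 2 on [w1, w1 + d[, so its integral would be
   positive. *)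
pose d := Num.min (e w1 / 4) (1 / 2).
have d0 : 0 < d by rewrite /d lt_min divr_gt0//=; lra.
have d1 : d <= 1 / 2 by rewrite /d ge_min lexx orbT.
have d2 : d <= e w1 / 4 by rewrite /d ge_min lexx.
have : (S >= (e w1 / 2 * d)%:E)%E.
  rewrite /S -(ge0_integral_period w1 (f := fun w => (e w)%:E))//; last first.
    by move=> w; rewrite eper.
  apply: (@le_trans _ _ (\int[mu]_(w in `[w1, (w1 + d)%R[) (e w)%:E))%E; last first.
    apply: ge0_subset_integral => //.
    - by apply: measurable_funTS.
    - by move=> w _; rewrite lee_fin.
    - by move=> w /=; rewrite !in_itv/=; lra.
  have -> : ((e w1 / 2 * d)%:E = \int[mu]_(w in `[w1, (w1 + d)%R[) (cst (e w1 / 2)%:E w))%E.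
    rewrite integral_cst//= lebesgue_measure_itv/= lte_fin ltrDl d0 -EFinD.
    by rewrite EFinM; congr (_ * _%:E)%E; ring.
  apply: ge0_le_integral => //.
  - by move=> w _; rewrite lee_fin divr_ge0.
  - by apply: measurable_funTS.
  - move=> w /=; rewrite in_itv/= => /andP[w1w ww1]; rewrite lee_fin.
    have h1 : `|w1 - w| <= 1 by rewrite ler_norml; lra.
    have := smoothed_lip rho w h1; rewrite subrKC distrC ger0_norm; last by lra.
    by rewrite /e in d2 ew1 *; lra.
rewrite sE lee_fin => H; have : 0 < e w1 / 2 * d by rewrite mulr_gt0// divr_gt0.
by lra.
Qed.

End max_principle.

(** * The support *)

Lemma intr_gap (R : realType) (k : int) : ~ (0 < (k%:~R : R) < 1).
Proof. by rewrite ltr0z -[1]/(1%:~R) ltr_int; case: k => [[|[]]|]. Qed.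

(** If x were missing from A, the nearest points of A on its two sides, which exist by compactness,
    would bound a gap. *)
Lemma closed_no_gap_convex (R : realType) (A : set R) : closed A ->
  (forall p q, A p -> A q -> p < q -> exists2 z, A z & p < z < q) ->
  forall p q x, A p -> A q -> p <= x <= q -> A x.
Proof.
move=> cA nogap p q x Ap Aq /andP[px xq]; apply: contrapT => Ax.
have [p' [Ap' p'x] p'max] : exists2 c, (A `&` `[p, x]) c & forall t, (A `&` `[p, x]) t -> t <= c.
  have [|||c cA' cmax] := @compact_EVT_max _ R (fun z : R => z) (A `&` `[p, x]).
  - by exists p; split => //=; rewrite in_itv/= lexx.
  - by rewrite setIC; apply: compact_closedI => //; exact: segment_compact.
  - by apply: continuous_subspaceT => z; exact: cvg_id.
  - by exists c => [|t tA]; [exact: set_mem|apply: cmax; exact: mem_set].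
have [q' [Aq' q'x] q'min] : exists2 c, (A `&` `[x, q]) c & forall t, (A `&` `[x, q]) t -> c <= t.
  have [|||c cA' cmin] := @compact_EVT_min _ R (fun z : R => z) (A `&` `[x, q]).
  - by exists q; split => //=; rewrite in_itv/= lexx xq.
  - by rewrite setIC; apply: compact_closedI => //; exact: segment_compact.
  - by apply: continuous_subspaceT => z; exact: cvg_id.
  - by exists c => [|t tA]; [exact: set_mem|apply: cmin; exact: mem_set].
move: p'x q'x; rewrite /= !in_itv/= => /andP[pp' p'x] /andP[xq' q'q].
have p'q' : p' < q'.
  rewrite lt_neqAle (le_trans p'x xq') andbT; apply/eqP => e.
  by apply: Ax; have -> : x = p' by apply/eqP; rewrite eq_le p'x e xq'.
have [z Az /andP[p'z zq']] := nogap _ _ Ap' Aq' p'q'.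
have [zx|xz] := leP z x.
  have := p'max z; rewrite /= in_itv/= zx andbT => /(_ (conj Az _)).
  by move=> /(_ (le_trans pp' (ltW p'z))); rewrite leNgt p'z.
have := q'min z; rewrite /= in_itv/= (ltW xz)/= => /(_ (conj Az _)).
by move=> /(_ (le_trans (ltW zq') q'q)); rewrite leNgt zq'.
Qed.

Lemma negligible_bigcup_countType d (T : measurableType d) (R : realType)
    (mu : {measure set T -> \bar R}) (I : countType) (F : I -> set T) :
  (forall i, mu.-negligible (F i)) -> mu.-negligible (\bigcup_i F i).
Proof.
move=> nF; pose G n := if unpickle n is Some i then F i else set0.
have nG n : mu.-negligible (G n).
  by rewrite /G; case: (unpickle n) => [i|]; [exact: nF|exact: negligible_set0].
apply: (negligibleS _ (negligible_bigcup nG)) => x [i _ Fix].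
by exists (pickle i) => //; rewrite /G pickleK.
Qed.

Section support.
Context {R : realType} (rho : probability (Rm R) R).

(** The support of the image of rho on the circle, as a periodic subset of the line: neighbourhoods
    are open arcs, on which rho is meaningful. *)
Definition arc_support : set R :=
  [set x | forall e, 0 < e -> (0 < rho (Toarc (x - e) (2 * e)))%E].

Lemma arc_support_periodic (k : int) x : arc_support (x + k%:~R) <-> arc_support x.
Proof.
have E (e : R) : Toarc (x + k%:~R - e) (2 * e) = Toarc (x - e) (2 * e).
  apply/seteqP; split => y [j yj].
    by exists (j - k); rewrite intrB; lra.
  by exists (j + k); rewrite intrD; lra.
by split => h e /h; rewrite E.
Qed.

Lemma arc_support_closed : closed arc_support.
Proof.
move=> x xc e e0; have e20 : 0 < e / 2 by rewrite divr_gt0.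
have [y [ys /=]] := xc _ (nbhsx_ballx x _ e20).
rewrite /ball/= => xy.
apply: (lt_le_trans (ys _ e20)); apply: le_measure; rewrite ?inE.
- exact: measurable_Toarc.
- exact: measurable_Toarc.
- by move=> z [k zk]; exists k; move: xy; rewrite ltr_norml; lra.
Qed.

(** The null arcs with rational endpoints are countably many and cover the complement of the
    support. *)
Lemma null_off_support (A : set R) : measurable (A : set (Rm R)) ->
  (forall x, A x -> ~ arc_support x) -> rho A = 0%E.
Proof.
move=> mA hA.
pose F (pq : rat * rat) : set (Rm R) :=
  [set x | rho (Toarc (ratr pq.1) (ratr pq.2 - ratr pq.1)) = 0%E /\
           Toarc (ratr pq.1) (ratr pq.2 - ratr pq.1) x].
have nF pq : rho.-negligible (F pq).
  exists (if rho (Toarc (ratr pq.1) (ratr pq.2 - ratr pq.1)) == 0%E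
    then Toarc (ratr pq.1) (ratr pq.2 - ratr pq.1) else set0).
  case: ifPn => [/eqP h|/eqP h]; split => //.
  - exact: measurable_Toarc.
  - by move=> x [].
  - by move=> x [].
have [N [mN N0 FN]] := negligible_bigcup_countType nF.
apply/eqP; rewrite eq_le measure_ge0 andbT -N0.
apply: le_measure; rewrite ?inE// => x /hA xs; apply: FN.
have [e [e0 he]] : exists e, 0 < e /\ rho (Toarc (x - e) (2 * e)) = 0%E.
  apply: contrapT => H; apply: xs => e e0; rewrite lt_neqAle measure_ge0 andbT.
  by apply/eqP => h; apply: H; exists e; split.
have [p px] : exists p : rat, x - e < ratr p < x.
  by have [p] := @rat_in_itvoo _ (x - e) x ltac:(lra); rewrite in_itv/=; exists p.
have [q xq] : exists q : rat, x < ratr q < x + e.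
  by have [q] := @rat_in_itvoo _ x (x + e) ltac:(lra); rewrite in_itv/=; exists q.
exists (p, q) => //; split => /=.
  apply/eqP; rewrite eq_le measure_ge0 andbT -he.
  apply: le_measure; rewrite ?inE; [exact: measurable_Toarc..|].
  by move=> z [k zk]; exists k; lra.
by exists 0; lra.
Qed.

Lemma meets_support (A : set R) : measurable (A : set (Rm R)) -> rho A <> 0%E ->
  exists2 x, A x & arc_support x.
Proof.
move=> mA A0; apply: contrapT => H; apply: A0; apply: null_off_support => // x Ax xs.
by apply: H; exists x.
Qed.

End support.

(** * Components of the support between poles of the potential *)

Section components.
Context {R : realType} (V : R -> \bar R) (C : R) (rho : probability (Rm R) R) (h : R).
Hypothesis kV : kernel_spec V C.
Local Notation mu := (@lebesgue_measure R).
Hypothesis hae : (\forall x \ae mu, (h%:E <= potential V rho x)%E).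
Local Notation U := (potential V rho).

Lemma potential_intr (k : int) x : U (x + k%:~R) = U x.
Proof. exact: (periodic_intr (potential_periodic kV rho)). Qed.

Lemma potential_le_closed : closed [set x | (U x <= h%:E)%E].
Proof.
move=> x xc; rewrite /= leNgt; apply/negP => hx.
have [e e0 he] := potential_lsc kV hx.
have [y [/= yU]] := xc _ (nbhsx_ballx x _ e0).
by rewrite /ball/= distrC => /he; rewrite ltNge yU.
Qed.

Lemma potential_atom x : rho (Tarc x 0) <> 0%E -> U x = +oo%E.
Proof.
move=> rx; apply/eqP; rewrite -leye_eq.
have mT : measurable (Tarc x 0 : set (Rm R)) by exact: measurable_Tarc.
apply: (@le_trans _ _ (\int[rho]_(y in Tarc x 0) V (x - y)%R)%E); last first.
  apply: ge0_subset_integral => //.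
  - exact: (measurable_kernel_reflect kV x).
  - by move=> y _; exact: (ker_ge0 kV).
have -> : (\int[rho]_(y in Tarc x 0) V (x - y)%R =
    \int[rho]_(y in Tarc x 0) (cst +oo y))%E.
  apply: eq_integral => y; rewrite inE => -[k]; rewrite addr0 => /andP[k1 k2].
  have -> : x - y = 0 + k%:~R by lra.
  by rewrite (periodic_intr (ker_per kV)) (ker_at0 kV).
by rewrite integral_cst// gt0_mulye// lt_neqAle measure_ge0 andbT; apply/eqP => /esym.
Qed.

(** By lower semicontinuity U > h near u and v, so the support between them is compact. Two of its
    points with none between would bound an arc without mass, excluded by [no_gap]; it therefore
    fills the interval between its extreme points. *)
Lemma support_component (u v : R) : v <= u + 1 -> U u = +oo%E -> U v = +oo%E ->
  (forall x, u < x < v -> arc_support rho x -> (U x <= h%:E)%E) ->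
  (forall x, u < x < v -> ~ arc_support rho x) \/
  exists a b, [/\ u < a, a <= b, b < v &
    forall x, u < x < v -> (arc_support rho x <-> a <= x <= b)].
Proof.
move=> vu Uu Uv Us.
have [N|/existsNP[x0 /not_implyP[x0I /contrapT x0s]]] :=
  pselect (forall x, u < x < v -> ~ arc_support rho x); first by left.
right.
have [e1 e10 he1] : exists2 e, 0 < e & forall y, `|y - u| < e -> (h%:E < U y)%E.
  by apply: (potential_lsc kV); rewrite Uu ltry.
have [e2 e20 he2] : exists2 e, 0 < e & forall y, `|y - v| < e -> (h%:E < U y)%E.
  by apply: (potential_lsc kV); rewrite Uv ltry.
pose A : set R := arc_support rho `&` `[u + e1, v - e2].
have AP x : u < x < v -> arc_support rho x -> A x.
  move=> xI xs; split => //=; rewrite in_itv/=.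
  have Ux := Us _ xI xs; apply/andP; split; rewrite leNgt; apply/negP => H.
    have : (h%:E < U x)%E by apply: he1; rewrite ltr_norml; lra.
    by rewrite ltNge Ux.
  have : (h%:E < U x)%E by apply: he2; rewrite ltr_norml; lra.
  by rewrite ltNge Ux.
have AI x : A x -> u < x < v by move=> [_ /=]; rewrite in_itv/=; lra.
have cA : compact A by rewrite /A setIC; apply: compact_closedI; [exact: segment_compact|exact: arc_support_closed].
have A0 : A x0 by exact: AP.
have cid : {within A, continuous (fun z : R => z)}.
  by apply: continuous_subspaceT => z; exact: cvg_id.
have [|||a aA amin] := @compact_EVT_min _ R (fun z : R => z) A => //; first by exists x0.
have [|||b bA bmax] := @compact_EVT_max _ R (fun z : R => z) A => //; first by exists x0.
move/set_mem in aA; move/set_mem in bA.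
exists a, b; split.
- by have := AI _ aA; lra.
- by apply: amin; exact: mem_set.
- by have := AI _ bA; lra.
move=> x xI; split => [xs|xab].
  have /mem_set Ax := AP _ xI xs.
  by rewrite (amin _ Ax) (bmax _ Ax).
have [] // : A x.
apply: (@closed_no_gap_convex R A) xab => //.
  by apply: compact_closed => //; exact: Rhausdorff.
move=> p q Ap Aq pq; apply: contrapT => H.
have pI := AI _ Ap; have qI := AI _ Aq.
apply: (no_gap kV pq _ _ (Us _ pI Ap.1) (Us _ qI Aq.1) hae); first lra.
apply: null_off_support; first exact: measurable_Toarc.
move=> z [k zk] zs; apply: H; exists (z + k%:~R); last by lra.
by apply: AP; [lra|exact/arc_support_periodic].
Qed.

(** The set {U <= h} is closed, periodic and nonempty. A gap in it contains no support point, hence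
    no mass, and [no_gap] excludes it; so x, lying between two translates of a support point,
    belongs to it. *)
Lemma support_all : arc_support rho `<=` [set x | (U x <= h%:E)%E] ->
  forall x, (U x <= h%:E)%E.
Proof.
move=> sU x.
have [z _ zs] : exists2 z, [set: R] z & arc_support rho z.
  by apply: meets_support => //; rewrite probability_setT => /eqP; rewrite onee_eq0.
have [k kx] := floor_fracP (x - z).
have zU (i : int) : (U (z + i%:~R) <= h%:E)%E by rewrite potential_intr; exact: sU.
apply: (@closed_no_gap_convex R [set x | (U x <= h%:E)%E] potential_le_closed _
  (z + k%:~R) (z + (k + 1)%:~R)) => //=; last by rewrite intrD; lra.
(* A gap is at most one period long, since p + 1 also belongs to the set. *)
move=> p q /= Up Uq pq; apply: contrapT => H.
have qp : q <= p + 1.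
  rewrite leNgt; apply/negP => h1; apply: H; exists (p + 1); last by lra.
  by have := potential_intr 1 p => /= ->.
apply: (no_gap kV pq qp _ Up Uq hae).
apply: null_off_support; first exact: measurable_Toarc.
move=> y [i yi] ys; apply: H; exists (y + i%:~R); last by lra.
by rewrite /= potential_intr; exact: sU.
Qed.

End components.

(** * Minimizers *)

Lemma ess_inf_addr (R : realType) (f : R -> \bar R) (c : R) :
  (ess_inf (@lebesgue_measure R) (fun x => f x + c%:E) =
   ess_inf (@lebesgue_measure R) f + c%:E)%E.
Proof.
have F := ae_filter_ringOfSetsType (@lebesgue_measure R).
apply/eqP; rewrite eq_le; apply/andP; split.
  rewrite -leeBlDr//; apply/ess_infP.
  apply: filterS (ess_inf_le (@lebesgue_measure R) (fun x => f x + c%:E)%E) => x.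
  by rewrite leeBlDr.
apply/ess_infP; apply: filterS (ess_inf_le (@lebesgue_measure R) f) => x.
by move=> fx; exact: leeD2r.
Qed.

Section shifted_kernel.
Context {R : realType} (V W : R -> \bar R) (C c : R).
Hypothesis kV : kernel_spec V C.
Hypothesis WV : forall x, W x = (V x - c%:E)%E.
Hypothesis Vc : (\int[@lebesgue_measure R]_(x in `[0%R, 1%R]) V x = c%:E)%E.
Variable nu : probability (Rm R) R.
Local Notation mu := (@lebesgue_measure R).

(** The delicate case is an infinite potential: the negative part of V - c is at most c, so the
    integral of the difference is still +oo. *)
Lemma conv_shift x : Defs.conv W nu x = (potential V nu x - c%:E)%E.
Proof.
have c0 : 0 <= c by rewrite -lee_fin -Vc; apply: integral_ge0 => y _; exact: (ker_ge0 kV).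
have mV := measurable_kernel_reflect kV x.
have V0 y := ker_ge0 kV (x - y).
have ic : nu.-integrable setT (fun _ : Rm R => c%:E).
  exact: finite_measure_integrable_cst.
have Ic : (\int[nu]_y c%:E = c%:E)%E by rewrite integral_cst//= probability_setT mule1.
rewrite /Defs.conv; under eq_integral do rewrite WV.
have [fin|] := ltP (\int[nu]_y V (x - y)%R)%E +oo%E.
  rewrite integralB ?Ic//; apply/integrableP; split => //.
  by under eq_integral do rewrite gee0_abs//.
rewrite leye_eq => /eqP inf; rewrite inf addye//.
pose g (y : Rm R) := (V (x - y)%R - c%:E)%E.
have mg : measurable_fun [set: Rm R] g by exact: emeasurable_funB.
rewrite integralE -/g.
have negfin : (\int[nu]_y g^\- y <= c%:E)%E.
  rewrite -Ic; apply: ge0_le_integral => //.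
  - exact: measurable_funeneg.
  - move=> y _; rewrite funenegE ge_max lee_fin c0 andbT /g.
    by rewrite leeNl leeBrDr// addeC subee.
have -> : (\int[nu]_y g^\+ y = +oo)%E.
  have : (\int[nu]_y V (x - y)%R <= \int[nu]_y g^\+ y + c%:E)%E.
    rewrite -[in leRHS]Ic -ge0_integralD//; last exact: measurable_funepos.
    apply: ge0_le_integral => //.
    - by apply: emeasurable_funD => //; exact: measurable_funepos.
    - by move=> y _; rewrite funeposE -leeBlDr// le_max lexx.
  by rewrite inf leye_eq; case: (\int[nu]_y _)%E.
by case: (\int[nu]_y g^\- y)%E negfin.
Qed.

Lemma Hfun_shift : Hfun W nu = (c%:E - ess_inf mu (potential V nu))%E.
Proof.
rewrite /Hfun (_ : Defs.conv W nu = fun x => (potential V nu x + (- c)%:E)%E).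
  by rewrite ess_inf_addr fin_num_oppeD// -EFinN opprK addeC.
by apply/funext => x; rewrite conv_shift.
Qed.

Lemma ess_inf_potential_bounds : (0 <= ess_inf mu (potential V nu) <= c%:E)%E.
Proof.
apply/andP; split.
  by apply/ess_infP; apply: aeW => x; exact: (potential_ge0 kV).
by rewrite -Vc; apply: (ess_inf_potential_le kV (rho := nu)); exact: ess_inf_le.
Qed.

End shifted_kernel.

(** Together with the lower bound d this makes D finite, so that [fine] in [Gfun] is harmless. *)
Lemma Dfun_le1 (R : realType) (nu : probability (Rm R) R) : (Dfun nu <= 1)%E.
Proof.
apply: ge_ereal_sup => _ [a _] [l /= /andP[l0 l1]] <-.
rewrite EFinN leeBlDr//; apply: (@le_trans _ _ 1%E).
  by apply: probability_le1; exact: measurable_Tarc.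
by rewrite -EFinD lee_fin lerDl.
Qed.

Lemma Dfun_ge (R : realType) (nu : probability (Rm R) R) (a l : R) : 0 <= l <= 1 ->
  (nu (Tarc a l) - l%:E <= Dfun nu)%E.
Proof. by move=> l01; apply: ereal_sup_ubound; exists a => //; exists l. Qed.

(** If nu(I) = rho(I), then D[nu] >= D[rho] >= d, so nu is admissible with a denominator at least as
    large and a strictly smaller numerator. *)
Lemma minimizer_no_improvement (R : realType) (V W : R -> \bar R) (C c alpha d a l : R)
    (rho nu : probability (Rm R) R) (h g : R) :
  kernel_spec V C -> (forall x, W x = (V x - c%:E)%E) ->
  (\int[@lebesgue_measure R]_(x in `[0%R, 1%R]) V x = c%:E)%E ->
  0 <= alpha -> 0 < d -> (d%:E <= Dfun rho)%E ->
  (forall nu : probability (Rm R) R,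
     (d%:E <= Dfun nu)%E -> (Gfun alpha W rho <= Gfun alpha W nu)%E) ->
  0 <= l <= 1 -> Dfun rho = (rho (Tarc a l) - l%:E)%E ->
  ess_inf (@lebesgue_measure R) (potential V rho) = h%:E ->
  0 < g -> (\forall x \ae @lebesgue_measure R, ((h + g)%:E <= potential V nu x)%E) ->
  nu (Tarc a l) <> rho (Tarc a l).
Proof.
move=> kV WV Vc alpha0 d0 dD rhomin l01 DI rhoh g0 nuh nuI.
have Dle : (Dfun rho <= Dfun nu)%E by rewrite DI -nuI; exact: Dfun_ge.
have := rhomin _ (le_trans dD Dle).
have /andP[hn0 hnc] := ess_inf_potential_bounds kV Vc nu.
have hn : ((h + g)%:E <= ess_inf (@lebesgue_measure R) (potential V nu))%E by exact/ess_infP.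
rewrite /Gfun !(Hfun_shift kV WV Vc) rhoh.
have := Dfun_le1 nu; have := Dfun_le1 rho.
case: (ess_inf _ _) hn0 hnc hn => [k| |] // _.
rewrite !lee_fin => kc hk.
case: (Dfun rho) dD Dle => [r| |] //; case: (Dfun nu) => [s| |] //.
rewrite !lee_fin /= => dr rs _ _ ; rewrite leNgt => /negP; apply.
have r0 : 0 < r by exact: lt_le_trans dr.
have pr0 : 0 < r `^ alpha by rewrite powR_gt0.
have prs : r `^ alpha <= s `^ alpha.
  by apply: ge0_ler_powR; rewrite ?nnegrE//; lra.
(* The denominators can be compared because c - k >= 0. *)
apply: (@le_lt_trans _ _ ((c - k) / r `^ alpha)).
  apply: ler_wpM2l; first by lra.
  by rewrite lef_pV2 ?posrE// (lt_le_trans pr0).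
by rewrite ltr_pM2r ?invr_gt0//; lra.
Qed.

(** * Consequences of optimality for the support and for the endpoints *)

Section minimizer_support.
Context {R : realType} (V : R -> \bar R) (C : R) (rho : probability (Rm R) R) (h M : R).
Hypothesis kV : kernel_spec V C.
Local Notation mu := (@lebesgue_measure R).
Local Notation U := (potential V rho).
Hypothesis h0 : 0 <= h.
Hypothesis hae : (\forall x \ae mu, (h%:E <= U x)%E).
Hypothesis M0 : 0 <= M.
Hypothesis optimal : forall (nu : probability (Rm R) R) (g : R), 0 < g ->
  (\forall x \ae mu, ((h + g)%:E <= potential V nu x)%E) ->
  nu (Tarc (- M) (2 * M)) <> rho (Tarc (- M) (2 * M)).

Lemma arc_off_endpoints x : ~ Tarc M 0 x -> ~ Tarc (- M) 0 x ->
  exists2 e, 0 < e & Toarc (x - e) (2 * e) `<=` Tarc (- M) (2 * M) \/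
                     Toarc (x - e) (2 * e) `<=` ~` Tarc (- M) (2 * M).
Proof.
move=> xM xNM; have [k xk] := floor_fracP (x + M).
have nM : x - k%:~R <> - M.
  by move=> e; apply: xNM; exists (- k); rewrite mulrNz e; lra.
have pM : x - k%:~R <> M.
  by move=> e; apply: xM; exists (- k); rewrite mulrNz e; lra.
have lM : - M < x - k%:~R.
  by rewrite lt_neqAle; apply/andP; split; [apply/eqP => /esym|lra].
have [xI|xI] := leP (x - k%:~R) M.
  have xI' : x - k%:~R < M by rewrite lt_neqAle xI andbT; exact/eqP.
  exists (Num.min (x - k%:~R + M) (M - (x - k%:~R))).
    by rewrite lt_min; lra.
  set e := Num.min _ _.
  have e1 : e <= x - k%:~R + M by rewrite /e ge_min lexx.
  have e2 : e <= M - (x - k%:~R) by rewrite /e ge_min lexx orbT.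
  by left => z [j zj]; exists (j - k); rewrite intrB; lra.
exists (Num.min (x - k%:~R - M) (1 - M - (x - k%:~R))).
  by rewrite lt_min; lra.
set e := Num.min _ _.
have e1 : e <= x - k%:~R - M by rewrite /e ge_min lexx.
have e2 : e <= 1 - M - (x - k%:~R) by rewrite /e ge_min lexx orbT.
right => z [j zj] [i zi]; apply: (@intr_gap R (j - k - i)).
by rewrite !intrB; lra.
Qed.

Lemma support_potential_le x : arc_support rho x -> ~ Tarc M 0 x -> ~ Tarc (- M) 0 x ->
  (U x <= h%:E)%E.
Proof.
move=> xs xM xNM; rewrite leNgt; apply/negP => hU.
have [eta eta0 hU'] : exists2 eta, 0 < eta & ((h + eta)%:E < U x)%E.
  case: (U x) hU => [r| |] //; last by exists 1 => //; rewrite ltry.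
  by rewrite lte_fin => hr; exists ((r - h) / 2); rewrite ?lte_fin; lra.
have [e1 e10 he1] := potential_lsc kV hU'.
have [e2 e20 he2] := arc_off_endpoints xM xNM.
(* Halved because the arc of radius 2 e must stay where U > h + eta and on one side of the boundary
   of I. *)
pose e := Num.min e1 e2 / 2.
have e0 : 0 < e by rewrite divr_gt0// lt_min e10.
have e1' : 2 * e <= e1 by rewrite /e mulrCA divff// mulr1 ge_min lexx.
have e2' : 2 * e <= e2 by rewrite /e mulrCA divff// mulr1 ge_min lexx orbT.
have [|nu [g [g0 nuh nuA]]] := sweep kV e0 eta0 h0 (xs _ e0) _ hae.
  move=> z [k zk]; rewrite -(potential_intr _ kV k); apply/ltW/he1.
  by rewrite ltr_norml; lra.
apply: (optimal g0 nuh); apply: nuA; first exact: Tset_Tarc.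
have sub : Toarc (x - 2 * e) (4 * e) `<=` Toarc (x - e2) (2 * e2).
  by move=> z [k zk]; exists k; lra.
by case: he2 => he2; [left|right]; exact: (subset_trans sub).
Qed.

Hypothesis heavy : ((2 * M)%:E < rho (Tarc (- M) (2 * M)))%E.

Lemma M_lt_half : M < 1 / 2.
Proof.
rewrite ltNge; apply/negP => M2.
have := lt_le_trans heavy (probability_le1 rho (measurable_Tarc _ _)).
by rewrite lte_fin; lra.
Qed.

(** Sweeping says nothing at M and -M themselves. If they are null, a support point with U > h has a
    neighbourhood with U > h whose mass lies off the endpoints, hence a support point there that
    contradicts [support_potential_le]. So U <= h everywhere, rho is uniform, and rho(I) <= 2 M
    contradicts [heavy]. *)
Lemma endpoints_charged : rho (Tarc M 0 `|` Tarc (- M) 0) <> 0%E.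
Proof.
set A0 := Tarc M 0 `|` _ => A00.
have mA0 : measurable (A0 : set (Rm R)) by apply: measurableU; exact: measurable_Tarc.
have supp_le : arc_support rho `<=` [set x | (U x <= h%:E)%E].
  move=> x xs; rewrite /= leNgt; apply/negP => hU.
  have [e e0 he] := potential_lsc kV hU.
  have mT : measurable (Toarc (x - e) (2 * e) : set (Rm R)) by exact: measurable_Toarc.
  have [||z [[k zk] zA0] zs] := @meets_support R rho (Toarc (x - e) (2 * e) `\` A0).
  - exact: measurableD.
  - move=> T0; have : (0 < rho (Toarc (x - e) (2 * e)))%E by exact: xs.
    rewrite (measureDI rho mT mA0) [X in (_ < X + _)%E]T0 add0e (subset_measure0 _ mA0 _ A00) ?ltxx//.
    exact: measurableI.
  - have : (U z <= h%:E)%E.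
      by apply: support_potential_le => // zA; apply: zA0; [left|right].
    rewrite leNgt => /negP; apply.
    by rewrite -(potential_intr _ kV k); apply: he; rewrite ltr_norml; lra.
have Uh := support_all kV hae supp_le.
have Uae : (\forall x \ae mu, U x = h%:E)%E.
  have F := ae_filter_ringOfSetsType mu; apply: filterS hae => x hx.
  by apply/eqP; rewrite eq_le hx Uh.
have [m fm] := smoothed_constant kV h0 Uae.
have := constant_smoothed_arc_le fm (s := M).
by rewrite M0 M_lt_half => /(_ isT); rewrite leNgt heavy.
Qed.


(** The arc J is exactly the support between u and v; hence a small arc around any of its points has
    positive mass, all of it in J. *)
Lemma component_arc (u v : R) : v <= u + 1 -> U u = +oo%E -> U v = +oo%E ->
  (forall x, u < x < v -> ~ (Tarc M 0 `|` Tarc (- M) 0) x) ->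
  exists J : set R, [/\
    J = set0 \/ exists a b, [/\ u < a, a <= b, b < v & J = Tarc a (b - a)],
    forall x, u < x < v -> arc_support rho x -> J x,
    J `<=` ~` (Tarc M 0 `|` Tarc (- M) 0) &
    forall c l, Toarc c l `&` J !=set0 -> (0 < rho (Toarc c l `&` J))%E].
Proof.
move=> vu Uu Uv offA0.
have Us x : u < x < v -> arc_support rho x -> (U x <= h%:E)%E.
  move=> xI xs; have xA0 := offA0 _ xI.
  by apply: support_potential_le => // xA; apply: xA0; [left|right].
have [none|[a [b [ua ab bv sab]]]] := support_component kV hae vu Uu Uv Us.
  exists set0; split => //; first by left.
  by move=> c l [x []].
exists (Tarc a (b - a)); split.
- by right; exists a, b.
- by move=> x xI /(sab _ xI) xab; exists 0; lra.
- move=> x [k xk] xA0; apply: (offA0 (x + k%:~R)); first by lra.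
  have [mT pT] := Tset_Tarc M 0; have [mT' pT'] := Tset_Tarc (- M) 0.
  by case: xA0 => xA; [left|right]; exact/Tset_intr.
move=> c l [x [[j xj] [k xk]]].
pose y := x + k%:~R.
have yI : u < y < v by rewrite /y; lra.
have ys : arc_support rho y by apply/sab => //; rewrite /y; lra.
(* The arc of radius e around y fits both in the given open arc, up to translation, and in ]u,
   v[. *)
pose e := Num.min (Num.min (x + j%:~R - c) (c + l - x - j%:~R)) (Num.min (y - u) (v - y)).
have e0 : 0 < e by rewrite !lt_min; lra.
have e1 : e <= x + j%:~R - c by rewrite /e !ge_min lexx.
have e2 : e <= c + l - x - j%:~R by rewrite /e !ge_min lexx orbT.
have e3 : e <= y - u by rewrite /e !ge_min lexx !orbT.
have e4 : e <= v - y by rewrite /e !ge_min lexx !orbT.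
have mB : measurable (Toarc (y - e) (2 * e) : set (Rm R)) by exact: measurable_Toarc.
have mJ : measurable (Tarc a (b - a) : set (Rm R)) by exact: measurable_Tarc.
apply: (lt_le_trans (ys _ e0)).
rewrite (measureDI rho mB mJ) [X in (X + _ <= _)%E](_ : _ = 0%E) ?add0e.
  apply: le_measure; rewrite ?inE; [exact: measurableI|apply: measurableI => //; exact: measurable_Toarc|].
  move=> z [[i zi] zJ]; split => //; exists (i - k + j).
  by move: zi; rewrite /y intrD intrB; lra.
apply: null_off_support; first exact: measurableD.
move=> z [[i zi] zJ] zs; apply: zJ; exists i.
suff : a <= z + i%:~R <= b by lra.
by apply/sab; [lra|exact/arc_support_periodic].
Qed.

Lemma off_endpoints (x : R) : - M < x < 1 - M -> x != M -> ~ (Tarc M 0 `|` Tarc (- M) 0) x.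
Proof.
have M2 := M_lt_half; have M0' := M0 => xI xM [|] [k xk].
  have [xltM|Mltx] : x < M \/ M < x by apply/orP; rewrite -neq_lt.
    by apply: (@intr_gap R k); lra.
  by apply: (@intr_gap R (- k)); rewrite mulrNz; lra.
by apply: (@intr_gap R (- k)); rewrite mulrNz; lra.
Qed.

Hypothesis rho_even : even_meas rho.

Lemma endpoint_masses : rho (Tarc (- M) 0) = rho (Tarc M 0).
Proof.
rewrite (rho_even (Tset_Tarc M 0)); congr (rho _).
apply/seteqP; split => [x [k xk]|_ [x [k xk] <-]].
  by exists (- x); [exists (- k); rewrite mulrNz; lra|rewrite opprK].
by exists (- k); rewrite mulrNz; lra.
Qed.

Lemma endpoint_mass_neq0 : rho (Tarc M 0) <> 0%E.
Proof.
move=> r0; apply: endpoints_charged; 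
have mT y : measurable (Tarc y 0 : set (Rm R)) by exact: measurable_Tarc.
by rewrite (measureU0 (mT M) (mT (- M)))//; exact: (etrans endpoint_masses r0).
Qed.

Lemma potential_endpoints : U M = +oo%E /\ U (- M) = +oo%E.
Proof.
by split; apply: (potential_atom kV); rewrite ?endpoint_masses; exact: endpoint_mass_neq0.
Qed.

(** A periodic set contains all translates of x or none, so on such sets the mass on the class of x
    acts as a Dirac mass at x. *)
Lemma measure_class_meet x (A : set R) : Tset A ->
  rho (A `&` Tarc x 0) = (rho (Tarc x 0) * \d_x A)%E.
Proof.
move=> [mA pA]; rewrite diracE.
have cls z : Tarc x 0 z -> (A z <-> A x).
  by move=> [k zk]; rewrite -(Tset_intr pA k) (_ : z + k%:~R = x) //; lra.
case: (boolP (x \in A)) => [|]; rewrite ?inE ?notin_setE => xA.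
  rewrite mule1; congr (rho _); apply/seteqP; split => [z []//|z zx].
  by split => //; exact/(cls _ zx).
rewrite mule0 (_ : _ `&` _ = set0) ?measure0//.
by apply/seteqP; split => // z [zA zx]; apply: xA; exact/(cls _ zx).
Qed.

(** Half the mass of the union is the right weight in both cases: for M > 0 the classes are
    disjoint, as M < 1/2, with equal masses by evenness; for M = 0 they coincide and the Dirac mass
    is counted twice. *)
Lemma endpoints_part (A : set R) : Tset A ->
  (rho (A `&` (Tarc M 0 `|` Tarc (- M) 0)) =
   (fine (rho (Tarc M 0 `|` Tarc (- M) 0)) / 2)%:E * (\d_M A + \d_(- M)%R A))%E.
Proof.
move=> TA; have [mA pA] := TA; have M2 := M_lt_half.
have mT y : measurable (Tarc y 0 : set (Rm R)) by exact: measurable_Tarc.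
have [r rE] : exists r, rho (Tarc M 0) = r%:E.
  by exists (fine (rho (Tarc M 0))); rewrite fineK// fin_num_measure.
have [M00|Mn0] := eqVneq M 0.
  have NM : - M = M by rewrite M00 oppr0.
  rewrite NM setUid measure_class_meet// rE diracE -EFinD -!EFinM /=.
  by congr EFin; field.
have disj : Tarc M 0 `&` Tarc (- M) 0 = set0.
  apply/seteqP; split => // z [[k zk] [j zj]].
  apply: (@intr_gap R (k - j)); rewrite intrB; have : 0 < M by rewrite lt0r Mn0.
  lra.
rewrite setIUr measureU; [|exact: measurableI|exact: measurableI|].
  transitivity (r%:E * \d_M A + r%:E * \d_(- M)%R A)%E.
    congr (_ + _)%E; rewrite -rE; first exact: measure_class_meet.
    by rewrite -endpoint_masses; exact: measure_class_meet.
  rewrite (_ : rho (_ `|` _) = r%:E + r%:E)%E; last first.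
    by rewrite measureU//; congr (_ + _)%E; [exact: rE|exact: (etrans endpoint_masses rE)].
  by rewrite !diracE -!EFinD -!EFinM -?EFinD /=; congr EFin; field.
by rewrite setIACA setIid disj setI0.
Qed.

End minimizer_support.

Theorem theorem3p6 (R : realType) (W : R -> \bar R) (alpha d M : R)
  (rho : probability (Rm R) R) :
  hyp_W W -> 0 <= alpha -> 0 < d <= 1 ->
  (* rho is in M_{D >= d} and minimizes G_alpha there *)
  (d%:E <= Dfun rho)%E ->
  (forall nu : probability (Rm R) R,
     (d%:E <= Dfun nu)%E -> (Gfun alpha W rho <= Gfun alpha W nu)%E) ->
  even_meas rho ->
  (* I = [-M, M] is a closed Tarc realizing D[rho] *)
  0 <= M <= 1 / 2 ->
  Dfun rho = (rho (Tarc (- M)%R (2 * M)%R) - ((2 * M)%R)%:E)%E ->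
  exists m : R, 0 < m <= 1 / 2 /\
  exists rho1 : {measure set (Rm R) -> \bar R},
    rho1 setT = (1 - 2 * m)%:E /\
    (forall A : set R, Tset A ->
       rho A = (m%:E * (\d_M A + \d_(- M)%R A) + rho1 A)%E) /\
    exists J K : set R,
      (* J closed interval, strictly inside I^c = (M, 1 - M) mod 1 *)
      (J = set0 \/ exists a b : R, M < a <= b /\ b < 1 - M /\ J = Tarc a (b - a)) /\
      (* K closed interval, strictly inside I = [-M, M] *)
      (K = set0 \/ exists a b : R, - M <= a <= b /\ b <= M /\
                    ~ (a = - M /\ b = M) /\ K = Tarc a (b - a)) /\
      (* rho1 is supported on J u K *)
      rho1 (~` (J `|` K)) = 0%E /\
      (* rho1 is non-zero on J and K: every open Tarc meeting J (resp. K)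
         carries positive rho1-mass inside J (resp. K) *)
      (forall c l : R, 0 < l <= 1 -> Toarc c l `&` J !=set0 ->
         (0 < rho1 (Toarc c l `&` J))%E) /\
      (forall c l : R, 0 < l <= 1 -> Toarc c l `&` K !=set0 ->
         (0 < rho1 (Toarc c l `&` K))%E).
Proof.
move=> hW alpha0 /andP[d0 _] dD rhomin rho_even /andP[M0 M2] DI.
have [V [c0 [C [kV WV Vc]]]] := kernel_of_hyp_W hW.
have {}WV x : W x = (V x - (- c0)%:E)%E by rewrite WV EFinN oppeK.
have M21 : 0 <= 2 * M <= 1 by lra.
have /andP[U0 Uc] := ess_inf_potential_bounds kV Vc rho.
have [h hE] : exists h, ess_inf (@lebesgue_measure R) (potential V rho) = h%:E.
  by case: (ess_inf _ _) U0 Uc => // h _ _; exists h.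
have h0 : 0 <= h by move: U0; rewrite hE.
have hae : (\forall x \ae @lebesgue_measure R, (h%:E <= potential V rho x)%E).
  by rewrite -hE; exact: ess_inf_le.
have optimal (nu : probability (Rm R) R) (g : R) : 0 < g ->
    (\forall x \ae @lebesgue_measure R, ((h + g)%:E <= potential V nu x)%E) ->
    nu (Tarc (- M) (2 * M)) <> rho (Tarc (- M) (2 * M)).
  exact: (minimizer_no_improvement kV WV Vc alpha0 d0 dD rhomin M21 DI hE).
have heavy : ((2 * M)%:E < rho (Tarc (- M) (2 * M)))%E.
  rewrite -sube_gt0 -DI; apply: lt_le_trans dD; by rewrite lte_fin.
have M12 := M_lt_half heavy.
pose A0 : set (Rm R) := Tarc M 0 `|` Tarc (- M) 0.
have mA0 : measurable A0 by apply: measurableU; exact: measurable_Tarc.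
have A0pos := endpoints_charged kV h0 hae M0 optimal heavy.
have [UM UNM] := potential_endpoints kV h0 hae M0 optimal heavy rho_even.
have part := endpoints_part M0 heavy rho_even.
have [z zE] : exists z, rho A0 = z%:E.
  by exists (fine (rho A0)); rewrite fineK// fin_num_measure.
have z1 : z <= 1 by rewrite -lee_fin -zE; exact: probability_le1.
have z0 : 0 < z.
  rewrite -lte_fin -zE lt_neqAle measure_ge0 andbT; apply/eqP => e; exact: A0pos.
rewrite -/A0 zE /= in part.
have [||||J [HJ suppJ JA0 posJ]] := component_arc kV h0 hae optimal (u := M) (v := 1 - M).
  by lra.
  exact: UM.
  by rewrite addrC -[1]/(1%:~R) (potential_intr _ kV).
  by move=> x xI; apply: (off_endpoints M0 heavy); [lra|apply/eqP; lra].
(* For M = 0 this interval is empty, which forces K = set0. *)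
have [||||K [HK suppK KA0 posK]] := component_arc kV h0 hae optimal (u := - M) (v := M).
  by lra.
  exact: UNM.
  exact: UM.
  by move=> x xI; apply: (off_endpoints M0 heavy); [lra|apply/eqP; lra].
exists (z / 2); split; first by lra.
(* The remainder rho_1 is rho restricted to the complement of the two endpoint classes. *)
exists (mrestr rho (measurableC mA0)); split.
  by rewrite /= /mrestr setTI probability_setC// zE -EFinB; congr EFin; field.
split.
  move=> A TA; have [mA _] := TA.
  rewrite -part //= /mrestr -setDE (measureDI rho mA mA0); exact: addeC.
have rho1E B : B `<=` ~` A0 -> mrestr rho (measurableC mA0) B = rho B.
  by move=> BA0; rewrite /mrestr setIidl.
have T0 : Tset (set0 : set R) by split.
have TJ : Tset J by case: HJ => [->//|[a [b [_ _ _ ->]]]]; exact: Tset_Tarc.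
have TK : Tset K by case: HK => [->//|[a [b [_ _ _ ->]]]]; exact: Tset_Tarc.
exists J, K; split; last split; last split; last split.
- case: HJ => [->|[a [b [ua ab bv ->]]]]; [by left|right].
  by exists a, b; rewrite ua ab bv.
- case: HK => [->|[a [b [ua ab bv ->]]]]; [by left|right].
  exists a, b; rewrite (ltW ua) ab (ltW bv); split => //; split => //; split => // -[e _].
  by move: ua; rewrite e ltxx.
- rewrite /= /mrestr; apply: null_off_support.
    apply: measurableI; last exact: measurableC.
    by apply: measurableC; apply: measurableU; [exact: TJ.1|exact: TK.1].
  move=> x [xJK xA0] xs; apply: xJK.
  (* The representative of x in [-M, 1 - M[ avoids -M and M, so it falls in the open arc of K or in
     that of J. *)
  have [k xk] := floor_fracP (x + M).
  have ys : arc_support rho (x + (- k)%:~R) by exact/arc_support_periodic.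
  have yM : x + (- k)%:~R <> M by move=> e; apply: xA0; left; exists (- k); lra.
  have yNM : x + (- k)%:~R <> - M by move=> e; apply: xA0; right; exists (- k); lra.
  rewrite mulrNz in ys yM yNM.
  have ltNM : - M < x - k%:~R by rewrite lt_neqAle; apply/andP; split; [apply/eqP => /esym|lra].
  have [yM'|yM'] := leP (x - k%:~R) M; [right|left].
    apply/(Tset_intr TK.2 (- k)); rewrite mulrNz; apply: suppK => //.
    by rewrite ltNM lt_neqAle yM' andbT; exact/eqP.
  by apply/(Tset_intr TJ.2 (- k)); rewrite mulrNz; apply: suppJ => //; lra.
- move=> c l _ ne; rewrite /= rho1E; last by move=> x [_ /JA0].
  exact: posJ.
- move=> c l _ ne; rewrite /= rho1E; last by move=> x [_ /KA0].
  exact: posK.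
Qed.
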